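(* Assume the sub-Gaussian streaming predictable model described in the context. Let $(\lambda_t)_{t\ge1}$ be a predictable sequence of positive parameters, i.e. $\lambda_t$ is $\mathcal H_{t-1}$-measurable for each $t$, and assume there is a positive constant $\lambda_\star$ with $\lambda_t\ge\lambda_\star$ for all $t$. Define $f_{\boldsymbol\lambda,t}(x)=k_t(x)^\top(\mathbf K_t+\lambda_{t+1}I_t)^{-1}Y_t$. Then for every $\delta\in(0,1]$, with probability at least $1-\delta$, simultaneously for all $x\in\mathcal X$ and all $t\ge0$, $$|f_\star(x)-f_{\boldsymbol\lambda,t}(x)|\le\sqrt{\frac{k_{\lambda_{t+1},t}(x,x)}{\lambda_{t+1}}}\Big[\sqrt{\lambda_{t+1}}\,\|f_\star\|_{\mathcal K}+\sigma\sqrt{2\ln(1/\delta)+2\gamma_t(\lambda_\star)}\Big].$$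
   Context: Let $\mathcal X$ be a compact set equipped with a positive finite Borel measure, and $k:\mathcal X\times\mathcal X\to\mathbb R$ a continuous, symmetric, positive definite kernel with RKHS $\mathcal K$ and norm $\|\cdot\|_{\mathcal K}$. Let $f_\star\in\mathcal K$ be unknown. At each time $t\ge1$ a point $x_t\in\mathcal X$ is chosen and $y_t=f_\star(x_t)+\xi_t$ is observed. There is a filtration $(\mathcal H_t)_{t\ge0}$ such that $x_t$ is $\mathcal H_{t-1}$-measurable and $y_t$ is $\mathcal H_t$-measurable. Sub-Gaussian streaming predictable model: for some constant $\sigma\ge0$, for all $t$ and all $u\in\mathbb R$, $\ln\mathbb E[\exp(u\xi_t)\mid\mathcal H_{t-1}]\le u^2\sigma^2/2$. Notation: $Y_t=(y_1,\dots,y_t)^\top$, $k_t(x)=(k(x,x_{t'}))_{t'\le t}$, $\mathbf K_t=(k(x_s,x_{s'}))_{s,s'\le t}$. For $\lambda>0$: $k_{\lambda,t}(x,x)=k(x,x)-k_t(x)^\top(\mathbf K_t+\lambda I_t)^{-1}k_t(x)$ (for $t=0$: no data, $k_{\lambda,0}(x,x)=k(x,x)$, and the estimate is $0$). The information gain is $\gamma_t(\lambda)=\frac12\sum_{t'=1}^t\ln\big(1+\frac1\lambda k_{\lambda,t'-1}(x_{t'},x_{t'})\big)$. *)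

(* Defs.v *)
From HB Require Import structures.
From mathcomp Require Import all_boot all_order all_algebra.
From mathcomp Require Import all_classical all_reals all_analysis.
From Stdlib Require List.
Set Implicit Arguments. Unset Strict Implicit. Unset Printing Implicit Defensive.
Import Order.TTheory GRing.Theory Num.Theory.
Import numFieldNormedType.Exports.
Local Open Scope classical_set_scope.
Local Open Scope ring_scope.

Section KernelDefs.
Variables (R : realType) (E : Type).
Implicit Types (k : E -> E -> R).

Definition comb_eval k (s : seq (R * E)) (x : E) : R :=
  \sum_(q <- s) q.1 * k q.2 x.

Definition comb_sqnorm k (s : seq (R * E)) : R :=
  \sum_(q <- s) \sum_(q' <- s) q.1 * q'.1 * k q.2 q'.2.

Definition comb_sub (s s' : seq (R * E)) : seq (R * E) :=
  s ++ map (fun q => (- q.1, q.2)) s'.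

Definition pd_kernel k (Xs : set E) : Prop :=
  forall s : seq (R * E), (forall q, List.In q s -> Xs q.2) ->
    0 <= comb_sqnorm k s.

(** [rkhs_norm_is k Xs f B]: f (restricted to Xs) belongs to the RKHS of k on
    Xs (Moore--Aronszajn completion of the span of the k(p,.) , p in Xs) and
    its RKHS norm equals B. *)
Definition rkhs_norm_is k (Xs : set E) (f : E -> R) (B : R) : Prop :=
  exists g : nat -> seq (R * E),
    [/\ (forall m q, List.In q (g m) -> Xs q.2),
        (forall e : R, 0 < e -> exists N : nat, forall m n : nat,
            (N <= m)%N -> (N <= n)%N -> comb_sqnorm k (comb_sub (g m) (g n)) <= e),
        (forall x, Xs x -> (fun m => comb_eval k (g m) x) @ \oo --> f x) &
        (fun m => Num.sqrt (comb_sqnorm k (g m))) @ \oo --> B].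

(** Kernel-regression quantities; xs, ys are indexed by time t >= 1,
    index i : 'I_t stands for time i+1. *)
Definition gram k (xs : nat -> E) (t : nat) : 'M[R]_t :=
  \matrix_(i < t, j < t) k (xs i.+1) (xs j.+1).

Definition kvec k (xs : nat -> E) (t : nat) (x : E) : 'cV[R]_t :=
  \col_(i < t) k x (xs i.+1).

Definition yvec (ys : nat -> R) (t : nat) : 'cV[R]_t :=
  \col_(i < t) ys i.+1.

Definition post_mean k (xs : nat -> E) (ys : nat -> R) (lam : R) (t : nat)
  (x : E) : R :=
  (((kvec k xs t x)^T *m invmx (gram k xs t + lam%:M) *m yvec ys t) ord0 ord0).

Definition post_var k (xs : nat -> E) (lam : R) (t : nat) (x : E) : R :=
  k x x - (((kvec k xs t x)^T *m invmx (gram k xs t + lam%:M)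
            *m kvec k xs t x) ord0 ord0).

Definition info_gain k (xs : nat -> E) (lam : R) (t : nat) : R :=
  2^-1 * \sum_(1 <= s < t.+1) ln (1 + post_var k xs lam s.-1 (xs s) / lam).

End KernelDefs.

Definition meas_wrt_R (T : Type) (R : realType) (G : set (set T)) (f : T -> R)
  : Prop := forall B : set R, measurable B -> G (f @^-1` B).

Definition meas_wrt_top (T : Type) (E : topologicalType) (G : set (set T))
  (f : T -> E) : Prop :=
  forall B : set E, <<s [set U : set E | open U] >> B -> G (f @^-1` B).

(* Main.v *)
(** For the noise xi and the regulariser l = lamstar put
    S_t = xi.xi - l xi.(K_t + l)^-1 xi. Block elimination gives
      S_(t+1) = S_t + xi^2 - l (xi - m)^2 / (v + l)
    with m and v the predictive mean and variance at x_(t+1), and averaging the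
    sub-Gaussian bound over a Gaussian exponent u shows that
    exp (S_t / (2 sigma^2) - gamma_t) is a supermartingale. Ville's inequality
    bounds S_t by sigma^2 (2 ln (1/delta) + 2 gamma_t) for all t at once.
    The random parameter lambda enters only deterministically: S_t decreases
    with l, so S_t at lambda is at most S_t at lamstar, and Cauchy-Schwarz
    bounds the squared noise term of the estimator by
    k_(lambda,t)(z,z) / lambda times S_t. The bias term is controlled by the
    reproducing inequality in the RKHS. *)

Require Import Defs.
From HB Require Import structures.
From mathcomp Require Import all_boot all_order all_algebra.
From mathcomp Require Import all_classical all_reals all_analysis.
From mathcomp Require Import measurable_realfun.
From mathcomp Require Import ring lra.
Import Order.TTheory GRing.Theory Num.Theory.
Import numFieldNormedType.Exports.
Local Open Scope classical_set_scope.
Local Open Scope ring_scope.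
Set Implicit Arguments.
Unset Strict Implicit.
Unset Printing Implicit Defensive.

(** In feature notation S_t = xi.K_t (K_t + l)^-1 xi is the squared norm of sum_s xi_s k(x_s, .) in
    the metric (V_t + l)^-1, where V_t is the sum of the rank-one operators k(x_s, .) (x) k(x_s, .):
    the usual self-normalised quantity. A mixture over all directions at once would need a Gaussian
    measure on the RKHS. Here one scalar Gaussian is used per step, its mean and variance depending
    on the past; its normalising factor is exactly the exponential of the increment of gamma_t. The
    recursion links consecutive energies at one and the same l, so it is run at the constant lamstar
    and not at a time-varying parameter. Two obstacles shape the rest. The noise hypothesis concerns
    constant exponents u, integrated over events of the past, while the mixture needs exponents that
    depend on the past; this is obtained by discretisation, without forming conditional
    expectations. Moreover every quantity must be measurable for the right member of the filtration,
    although [k] is continuous only on [Xs] x [Xs], the points are merely Borel in a space without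
    countability assumptions, and [fstar] is given only as an RKHS limit. *)

Lemma quadratic_ge0_disc (R : realFieldType) (a b c : R) : 0 <= c ->
  (forall r, 0 <= a + 2 * r * b + r ^+ 2 * c) -> b ^+ 2 <= a * c.
Proof.
rewrite le_eqVlt => /orP[/eqP <-|c0] h.
  rewrite mulr0.
  have [->|b0] := eqVneq b 0; first by rewrite expr0n.
  (* For c = 0 the expression is affine in r, and this r would give it the value -1. *)
  have := h (- (a + 1) / (2 * b)).
  have -> : 2 * (- (a + 1) / (2 * b)) * b = - (a + 1) by field.
  by rewrite mulr0; lra.
have := h (- b / c).
have -> : a + 2 * (- b / c) * b + (- b / c) ^+ 2 * c = a - b ^+ 2 / c.
  by field; rewrite gt_eqF.
by rewrite subr_ge0 ler_pdivrMr.
Qed.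

(** * Kernel combinations and the reproducing bound *)

Section Combinations.
Variables (R : realType) (E : Type) (k : E -> E -> R) (Xs : set E).
Hypothesis k_sym : forall a b, Xs a -> Xs b -> k a b = k b a.
Hypothesis k_pd : pd_kernel k Xs.
Implicit Types s : seq (R * E).

Definition comb_inner s s' : R :=
  \sum_(q <- s) \sum_(q' <- s') q.1 * q'.1 * k q.2 q'.2.

Definition comb_in s := forall q, List.In q s -> Xs q.2.

Definition comb_scale (r : R) s := [seq (r * q.1, q.2) | q <- s].

Lemma eq_big_In (A : Type) (s : seq A) (F G : A -> R) :
  (forall q, List.In q s -> F q = G q) ->
  \sum_(q <- s) F q = \sum_(q <- s) G q.
Proof.
elim: s => [|q s ih] h; first by rewrite !big_nil.
by rewrite !big_cons h ?ih => //= [q' ?|]; [apply: h; right|left].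
Qed.

Lemma comb_innerC s s' : comb_in s -> comb_in s' ->
  comb_inner s s' = comb_inner s' s.
Proof.
move=> hs hs'; rewrite /comb_inner exchange_big/=.
apply: eq_big_In => q hq; apply: eq_big_In => q' hq'.
by rewrite k_sym; [ring|exact: hs|exact: hs'].
Qed.

Lemma comb_inner_catl s1 s2 s' :
  comb_inner (s1 ++ s2) s' = comb_inner s1 s' + comb_inner s2 s'.
Proof. exact: big_cat. Qed.

Lemma comb_inner_scalel r s s' :
  comb_inner (comb_scale r s) s' = r * comb_inner s s'.
Proof.
rewrite /comb_inner big_map mulr_sumr; apply: eq_bigr => q _.
by rewrite mulr_sumr; apply: eq_bigr => q' _ /=; ring.
Qed.

Lemma comb_in_cat s s' : comb_in s -> comb_in s' -> comb_in (s ++ s').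
Proof.
by move=> hs hs' q h; case: (List.in_app_or _ _ _ h) => [/hs|/hs'].
Qed.

Lemma comb_in_scale r s : comb_in s -> comb_in (comb_scale r s).
Proof.
move=> hs; rewrite /comb_scale => q h.
by case/List.in_map_iff: h => q' [<-] /hs.
Qed.

Lemma comb_cauchy_schwarz s s' : comb_in s -> comb_in s' ->
  `|comb_inner s s'| <=
  Num.sqrt (comb_sqnorm k s) * Num.sqrt (comb_sqnorm k s').
Proof.
move=> hs hs'; rewrite -sqrtrM ?k_pd// -sqrtr_sqr ler_sqrt; last first.
  by rewrite mulr_ge0 // k_pd.
apply: quadratic_ge0_disc => [|r]; first exact: k_pd.
have hr := comb_in_scale (r := r) hs'.
suff -> : comb_sqnorm k s + 2 * r * comb_inner s s' + r ^+ 2 * comb_sqnorm k s'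
  = comb_sqnorm k (s ++ comb_scale r s') by apply: k_pd; exact: comb_in_cat.
rewrite -![comb_sqnorm _ _]/(comb_inner _ _) comb_inner_catl.
rewrite comb_inner_scalel !(comb_innerC (s' := s ++ _)) ?comb_inner_catl//;
  try exact: comb_in_cat.
by rewrite !comb_inner_scalel (comb_innerC hs' hs)//; ring.
Qed.

(** Since [f] is the pointwise limit of the combinations [g m], the sum is the limit of the inner
    products of [s] with [g m], and Cauchy-Schwarz holds for each of them. This yields the
    reproducing inequality without constructing the completed space. *)
Lemma rkhs_bound f B s : rkhs_norm_is k Xs f B -> comb_in s ->
  `|\sum_(q <- s) q.1 * f q.2| <= Num.sqrt (comb_sqnorm k s) * B.
Proof.
move=> [g [gX _ gf gB]] hs.
have cv1 : (fun m => \sum_(q <- s) q.1 * comb_eval k (g m) q.2) @ \oo -->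
    \sum_(q <- s) q.1 * f q.2.
  elim: s hs => [|q s ih] hs.
    rewrite big_nil; under eq_cvg do rewrite big_nil; exact: cvg_cst.
  rewrite big_cons; under eq_cvg do rewrite big_cons.
  apply: cvgD; last by apply: ih => q' hq'; apply: hs; right.
  by apply: cvgM; [exact: cvg_cst|apply: gf]; apply: hs; left.
have cv2 : (fun m => Num.sqrt (comb_sqnorm k s) *
    Num.sqrt (comb_sqnorm k (g m))) @ \oo --> Num.sqrt (comb_sqnorm k s) * B.
  by apply: cvgM => //; exact: cvg_cst.
have := ler_cvg_to (cvg_norm cv1) cv2; apply.
near=> m.
rewrite (_ : \sum_(q <- s) _ = comb_inner s (g m)); last first.
  apply: eq_big_In => q hq; rewrite /comb_eval mulr_sumr.
  apply: eq_big_In => q' hq'; rewrite (k_sym (hs _ hq) (gX _ _ hq')).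
  by rewrite mulrA.
by apply: comb_cauchy_schwarz => // q; exact: gX.
Unshelve. all: by end_near. Qed.

Lemma rkhs_norm_ge0 f B : rkhs_norm_is k Xs f B -> 0 <= B.
Proof.
move=> [g [_ _ _ gB]]; have := ler_cvg_to (cvg_cst 0) gB; apply.
by apply: nearW => m; exact: sqrtr_ge0.
Qed.

End Combinations.

(** * Ridge regression *)

Definition dotc (R : pzSemiRingType) t (u w : 'cV[R]_t) : R :=
  (u^T *m w) ord0 ord0.

Section DotProduct.
Variables (R : realDomainType) (t : nat).
Implicit Types u w : 'cV[R]_t.

Lemma dotcE u w : dotc u w = \sum_i u i ord0 * w i ord0.
Proof. by rewrite /dotc mxE; apply: eq_bigr => i _; rewrite mxE. Qed.

Lemma dotcC u w : dotc u w = dotc w u.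
Proof. by rewrite !dotcE; apply: eq_bigr => i _; rewrite mulrC. Qed.

Lemma dotcDl u1 u2 w : dotc (u1 + u2) w = dotc u1 w + dotc u2 w.
Proof. by rewrite /dotc linearD mulmxDl mxE. Qed.

Lemma dotcDr u w1 w2 : dotc u (w1 + w2) = dotc u w1 + dotc u w2.
Proof. by rewrite /dotc mulmxDr mxE. Qed.

Lemma dotcZl r u w : dotc (r *: u) w = r * dotc u w.
Proof. by rewrite /dotc linearZ -scalemxAl mxE. Qed.

Lemma dotcZr r u w : dotc u (r *: w) = r * dotc u w.
Proof. by rewrite /dotc -scalemxAr mxE. Qed.

Lemma dotcNl u w : dotc (- u) w = - dotc u w.
Proof. by rewrite -scaleN1r dotcZl mulN1r. Qed.

Lemma dotcNr u w : dotc u (- w) = - dotc u w.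
Proof. by rewrite dotcC dotcNl dotcC. Qed.

Lemma dotcM (A : 'M[R]_t) u w : dotc u (A *m w) = dotc (A^T *m u) w.
Proof. by rewrite /dotc trmx_mul trmxK mulmxA. Qed.

Lemma dotc_ge0 u : 0 <= dotc u u.
Proof. by rewrite dotcE sumr_ge0// => i _; rewrite -expr2 sqr_ge0. Qed.

Lemma dotc_eq0 u : dotc u u = 0 -> u = 0.
Proof.
rewrite dotcE => /eqP; rewrite psumr_eq0; last first.
  by move=> i _; rewrite -expr2 sqr_ge0.
move=> /allP h; apply/matrixP => i j; rewrite ord1 mxE.
have := h i; rewrite mem_index_enum => /(_ isT).
by rewrite -expr2 sqrf_eq0 => /eqP.
Qed.

End DotProduct.

Section Ridge.
Variables (R : realFieldType) (t : nat) (K : 'M[R]_t).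
Hypothesis K_sym : K^T = K.
Hypothesis K_psd : forall c, 0 <= dotc c (K *m c).
Implicit Types (l : R) (c u v : 'cV[R]_t).

(** For positive [l] this is u.K (K + l)^-1 u; the form with the subtraction is the one that behaves
    well under block elimination and under a change of [l]. *)
Definition ridge_energy l u := dotc u u - l * dotc u (invmx (K + l%:M) *m u).

Lemma ridge_mul l c : (K + l%:M) *m c = K *m c + l *: c.
Proof. by rewrite mulmxDl mul_scalar_mx. Qed.

Lemma ridge_sym l : (K + l%:M)^T = K + l%:M.
Proof. by rewrite linearD/= K_sym tr_scalar_mx. Qed.

Lemma ridge_unit l : 0 < l -> K + l%:M \in unitmx.
Proof.
move=> l0; rewrite -row_free_unit; apply: inj_row_free => v hv.
have h : (K + l%:M) *m v^T = 0.
  by apply: trmx_inj; rewrite trmx_mul trmxK ridge_sym hv linear0.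
have : dotc v^T ((K + l%:M) *m v^T) = 0 by rewrite h /dotc mulmx0 mxE.
rewrite ridge_mul dotcDr dotcZr => h1.
have : dotc v^T v^T = 0.
  have h2 := K_psd v^T; have h3 := mulr_ge0 (ltW l0) (dotc_ge0 v^T).
  have /eqP : l * dotc v^T v^T = 0 by lra.
  by rewrite mulf_eq0 gt_eqF//= => /eqP.
by move/dotc_eq0 => h2; apply: trmx_inj; rewrite h2 linear0.
Qed.

Lemma ridge_solve l u : 0 < l ->
  let c := invmx (K + l%:M) *m u in K *m c + l *: c = u.
Proof. by move=> l0 c; rewrite -ridge_mul mulmxA mulmxV ?mul1mx// ridge_unit. Qed.

Lemma dotc_symm u w : dotc u (K *m w) = dotc (K *m u) w.
Proof. by rewrite dotcM K_sym. Qed.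

Lemma dotc_ridge_inv l u w : dotc u (invmx (K + l%:M) *m w) =
  dotc w (invmx (K + l%:M) *m u).
Proof. by rewrite dotcM trmx_inv ridge_sym dotcC. Qed.

(* l u.(K + l)^-1 u is the maximum over b of 2 b.u - b.(K / l + 1) b, hence
   increases with l; the proof exhibits the gap as a sum of nonnegative terms. *)
Lemma ridge_energy_anti l l' u : 0 < l -> l <= l' ->
  ridge_energy l' u <= ridge_energy l u.
Proof.
move=> l0 ll'; have l'0 : 0 < l' by exact: lt_le_trans ll'.
rewrite /ridge_energy lerD2l lerN2.
set c := _ *m u; set c' := _ *m u.
have e := ridge_solve u l0; have e' := ridge_solve u l'0.
rewrite -/c in e; rewrite -/c' in e'.
pose b := l *: c - l' *: c'.
have hb := K_psd b; have hb2 := dotc_ge0 b; have hc := K_psd c.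
have eq1 : dotc u c = dotc c (K *m c) + l * dotc c c.
  by rewrite -{1}e dotcDl dotcZl dotcC.
have eq2 : dotc u c' = dotc c' (K *m c') + l' * dotc c' c'.
  by rewrite -{1}e' dotcDl dotcZl dotcC.
have eq3 : dotc u c' = dotc c (K *m c') + l * dotc c c'.
  by rewrite -{1}e dotcDl dotcZl -dotc_symm.
have eq4 : dotc u c = dotc c (K *m c') + l' * dotc c c'.
  by rewrite -{1}e' dotcDl dotcZl (dotcC (K *m c')) (dotcC c').
have : l * l' * (l' * dotc u c' - l * dotc u c) =
  l * dotc b (K *m b) + l * l' * dotc b b + (l' - l) * l ^+ 2 * dotc c (K *m c).
  have eq5 : dotc c' (K *m c) = dotc c (K *m c') by rewrite dotc_symm dotcC.
  rewrite /b mulmxBr !(dotcDl, dotcDr) -!scalemxAr.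
  rewrite !(dotcNl, dotcNr, dotcZl, dotcZr) eq5 (dotcC c' c).
  have -> : dotc c (K *m c) = dotc u c - l * dotc c c by lra.
  have -> : dotc c' (K *m c') = dotc u c' - l' * dotc c' c' by lra.
  have -> : dotc c (K *m c') = dotc u c - l' * dotc c c' by lra.
  by ring.
move=> h.
have : 0 <= l * l' * (l' * dotc u c' - l * dotc u c).
  rewrite h !addr_ge0 ?mulr_ge0 ?subr_ge0 ?sqr_ge0 // ltW//.
by rewrite pmulr_rge0 ?mulr_gt0// subr_ge0.
Qed.

Section ExtraPoint.
Variables (kappa : R) (v : 'cV[R]_t) (l : R).
(** Positivity of the matrix [K] bordered by [v] and [kappa], tested on vectors whose last
    coordinate is 1. *)
Hypothesis ext_psd : forall c, 0 <= kappa + 2 * dotc c v + dotc c (K *m c).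
Hypothesis l0 : 0 < l.

Let a := invmx (K + l%:M) *m v.
Let pv := kappa - dotc v a.

(** In features the left side is the squared norm of k(z, .) - sum_i a_i k(x_i, .), the residual of
    the ridge fit of k(z, .). The variance [pv] is this plus the penalty [l * dotc a a], which is
    dropped. *)
Lemma ridge_var_bias : kappa - 2 * dotc a v + dotc a (K *m a) <= pv.
Proof.
have e := ridge_solve v l0; rewrite -/a in e.
have : dotc a v = dotc a (K *m a) + l * dotc a a.
  by rewrite -{1}e dotcDr dotcZr.
rewrite /pv (dotcC v); have := mulr_ge0 (ltW l0) (dotc_ge0 a); lra.
Qed.

Lemma ridge_var_ge0 : 0 <= pv.
Proof.
apply: le_trans ridge_var_bias.
have := ext_psd (- a); rewrite mulmxN !dotcNl dotcNr; lra.
Qed.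

(* With k(z, .) = phi, K = Phi Phi^T and c = (K + l)^-1 u, this is the
   Cauchy-Schwarz inequality between (phi - Phi^T a, sqrt l a) and
   (Phi^T c, K c / sqrt l). *)
Lemma ridge_noise u :
  (dotc v (invmx (K + l%:M) *m u)) ^+ 2 <= pv / l * ridge_energy l u.
Proof.
rewrite dotc_ridge_inv -/a /ridge_energy.
set c := _ *m u.
have e := ridge_solve v l0; rewrite -/a in e.
have e' := ridge_solve u l0; rewrite -/c in e'.
have -> : dotc u u - l * dotc u c = dotc (K *m c) (K *m c) + l * dotc c (K *m c).
  rewrite -e' !(dotcDl, dotcDr, dotcZl, dotcZr) (dotcC (K *m c) c); ring.
rewrite mulrAC -mulrA.
apply: quadratic_ge0_disc => [|r].
  rewrite mulr_ge0 ?invr_ge0 ?(ltW l0)//.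
  by rewrite addr_ge0 ?dotc_ge0// mulr_ge0 ?(ltW l0).
have h1 := ext_psd (r *: c - a); have h2 := dotc_ge0 (a + (r / l) *: (K *m c)).
apply: le_trans (addr_ge0 h1 (mulr_ge0 (ltW l0) h2)) _.
have av : dotc a v = dotc v a by exact: dotcC.
have va : dotc v a = dotc a (K *m a) + l * dotc a a.
  by rewrite -{1}e dotcDl dotcZl dotcC.
have vc : dotc c v = dotc c (K *m a) + l * dotc c a.
  by rewrite -{1}e dotcDr dotcZr.
have ua : dotc u a = dotc c v.
  by rewrite -e' dotcDl dotcZl vc -dotc_symm.
rewrite mulmxBr !(dotcDl, dotcDr) -!scalemxAr.
rewrite !(dotcNl, dotcNr, dotcZl, dotcZr) ua /pv vc av va.
have -> : dotc a (K *m c) = dotc c (K *m a) by rewrite dotc_symm dotcC.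
have -> : dotc (K *m c) a = dotc c (K *m a) by rewrite dotc_symm.
rewrite le_eqVlt; apply/orP; left; apply/eqP; field.
by rewrite gt_eqF.
Qed.

End ExtraPoint.
End Ridge.

Section KernelRidge.
Variables (R : realType) (E : Type) (k : E -> E -> R) (Xs : set E).
Hypothesis k_sym : forall a b, Xs a -> Xs b -> k a b = k b a.
Hypothesis k_pd : pd_kernel k Xs.
Variable xs : nat -> E.
Hypothesis xsX : forall t, Xs (xs t.+1).
Implicit Types (l : R) (ys : nat -> R) (z : E).

Definition points_comb t (c : 'cV[R]_t) : seq (R * E) :=
  [seq (c i ord0, xs i.+1) | i <- index_enum 'I_t].

Lemma points_comb_in t (c : 'cV[R]_t) : comb_in Xs (points_comb c).
Proof. by move=> q h; case/List.in_map_iff: h => i [<- _]; exact: xsX. Qed.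

Lemma comb_inner_points t (c c' : 'cV[R]_t) :
  comb_inner k (points_comb c) (points_comb c') = dotc c (gram k xs t *m c').
Proof.
rewrite /comb_inner big_map dotcE; apply: eq_bigr => i _.
rewrite big_map mxE mulr_sumr; apply: eq_bigr => j _ /=; rewrite !mxE; ring.
Qed.

Lemma gram_sym t : (gram k xs t)^T = gram k xs t.
Proof. by apply/matrixP => i j; rewrite !mxE k_sym. Qed.

Lemma gram_psd t (c : 'cV[R]_t) : 0 <= dotc c (gram k xs t *m c).
Proof. rewrite -comb_inner_points; exact/k_pd/points_comb_in. Qed.

Lemma comb_in_cons t (c : 'cV[R]_t) z : Xs z ->
  comb_in Xs ((1, z) :: points_comb c).
Proof. by move=> zX q [<-//|]; exact: points_comb_in. Qed.

Lemma comb_sqnorm_cons t (c : 'cV[R]_t) z : Xs z ->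
  comb_sqnorm k ((1, z) :: points_comb c) =
  k z z + 2 * dotc c (kvec k xs t z) + dotc c (gram k xs t *m c).
Proof.
move=> zX; rewrite -comb_inner_points /comb_sqnorm big_cons big_cons/=.
under [X in _ + X]eq_bigr do rewrite big_cons.
rewrite big_split/= -[X in _ + (_ + X)]/(comb_inner k _ _).
suff [-> ->] :
    \sum_(q <- points_comb c) 1 * q.1 * k z q.2 = dotc c (kvec k xs t z) /\
    \sum_(q <- points_comb c) q.1 * 1 * k q.2 z = dotc c (kvec k xs t z).
  by ring.
split; rewrite big_map dotcE; apply: eq_bigr => i _ /=; rewrite !mxE; first ring.
by rewrite (k_sym (xsX _))// mulr1.
Qed.

Lemma kvec_psd t z : Xs z -> forall c : 'cV[R]_t,
  0 <= k z z + 2 * dotc c (kvec k xs t z) + dotc c (gram k xs t *m c).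
Proof. by move=> zX c; rewrite -comb_sqnorm_cons//; exact/k_pd/comb_in_cons. Qed.

Lemma post_meanE ys l t z : post_mean k xs ys l t z =
  dotc (kvec k xs t z) (invmx (gram k xs t + l%:M) *m yvec ys t).
Proof. by rewrite /post_mean /dotc mulmxA. Qed.

Lemma post_varE l t z : post_var k xs l t z = k z z -
  dotc (kvec k xs t z) (invmx (gram k xs t + l%:M) *m kvec k xs t z).
Proof. by rewrite /post_var /dotc mulmxA. Qed.

Lemma post_meanD ys ys' l t z :
  post_mean k xs (fun s => ys s + ys' s) l t z =
  post_mean k xs ys l t z + post_mean k xs ys' l t z.
Proof.
rewrite !post_meanE -dotcDr -mulmxDr; congr (dotc _ (_ *m _)).
by apply/matrixP => i j; rewrite !mxE.
Qed.

Lemma post_mean_ext ys ys' l t z : (forall s, ys s.+1 = ys' s.+1) ->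
  post_mean k xs ys l t z = post_mean k xs ys' l t z.
Proof.
move=> h; rewrite !post_meanE; congr (dotc _ (_ *m _)).
by apply/matrixP => i j; rewrite !mxE h.
Qed.

Lemma post_var_ge0 l t z : 0 < l -> Xs z -> 0 <= post_var k xs l t z.
Proof.
move=> l0 zX; rewrite post_varE.
exact: (ridge_var_ge0 (gram_sym t) (@gram_psd t) (kvec_psd zX) l0).
Qed.

Definition fit_energy ys l t := ridge_energy (gram k xs t) l (yvec ys t).

Lemma fit_energy0 ys l : fit_energy ys l 0 = 0.
Proof. by rewrite /fit_energy /ridge_energy !dotcE !big_ord0 mulr0 subr0. Qed.

Lemma fit_energy_anti ys l l' t : 0 < l -> l <= l' ->
  fit_energy ys l' t <= fit_energy ys l t.
Proof. move=> l0; exact: (ridge_energy_anti (gram_sym t) (@gram_psd t)). Qed.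

Lemma post_mean_sqr_le ys l t z : 0 < l -> Xs z ->
  post_mean k xs ys l t z ^+ 2 <=
  post_var k xs l t z / l * fit_energy ys l t.
Proof.
move=> l0 zX; rewrite post_meanE post_varE.
exact: (ridge_noise (gram_sym t) (@gram_psd t) (kvec_psd zX) l0).
Qed.

(** With a = (K + l)^-1 k_t(z), the noiseless estimate is sum_i a_i f(x_i). The error is therefore
    the combination k(z, .) - sum_i a_i k(x_i, .) tested on [f], and [rkhs_bound] together with
    [ridge_var_bias] bounds it. *)
Lemma post_mean_bias f B l t z : rkhs_norm_is k Xs f B -> 0 < l -> Xs z ->
  `|f z - post_mean k xs (fun s => f (xs s)) l t z| <=
  Num.sqrt (post_var k xs l t z) * B.
Proof.
move=> fB l0 zX.
pose a := invmx (gram k xs t + l%:M) *m kvec k xs t z.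
have aX := comb_in_cons (c := - a) zX.
have := rkhs_bound k_sym k_pd fB aX.
rewrite (_ : \sum_(q <- _) _ = f z - post_mean k xs (fun s => f (xs s)) l t z);
  last first.
  rewrite big_cons mul1r; congr (_ + _).
  rewrite post_meanE (dotc_ridge_inv (gram_sym t)) -/a dotcC -dotcNl dotcE.
  by rewrite big_map; apply: eq_bigr => i _ /=; rewrite !mxE.
move=> /le_trans; apply; apply: ler_wpM2r; first exact: rkhs_norm_ge0 fB.
rewrite ler_sqrt ?post_var_ge0// comb_sqnorm_cons// mulmxN dotcNl !dotcNl dotcNr.
rewrite opprK mulrN post_varE.
exact: (ridge_var_bias (gram_sym t) (@gram_psd t) (k z z) (kvec k xs t z) l0).
Qed.

End KernelRidge.

(** * Appending one observation to a ridge regression *)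

Definition rcons_col (R : Type) t (u : 'cV[R]_t) (r : R) : 'cV[R]_t.+1 :=
  \col_(i < t.+1) if unlift ord_max i is Some j then u j ord0 else r.

Lemma widen_lift_max t (i : 'I_t) : widen_ord (leqnSn t) i = lift ord_max i.
Proof. by apply: val_inj; rewrite [RHS]lift_max. Qed.

Lemma rcons_col_lift (R : Type) t (u : 'cV[R]_t) r i :
  rcons_col u r (widen_ord (leqnSn t) i) ord0 = u i ord0.
Proof. by rewrite mxE widen_lift_max liftK. Qed.

Lemma rcons_col_max (R : Type) t (u : 'cV[R]_t) r :
  rcons_col u r ord_max ord0 = r.
Proof. by rewrite mxE unlift_none. Qed.

Lemma dotc_rcons (R : realDomainType) t (u w : 'cV[R]_t) r r' :
  dotc (rcons_col u r) (rcons_col w r') = dotc u w + r * r'.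
Proof.
rewrite !dotcE big_ord_recr/= !rcons_col_max; congr (_ + _).
by apply: eq_bigr => i _; rewrite !rcons_col_lift.
Qed.

Section RidgeExtension.
Variables (R : realFieldType) (t : nat) (K : 'M[R]_t) (K' : 'M[R]_t.+1).
Variables (v : 'cV[R]_t) (kappa : R).
Hypothesis K_sym : K^T = K.
Hypothesis K_psd : forall c, 0 <= dotc c (K *m c).
Hypothesis K'_sym : K'^T = K'.
Hypothesis K'_psd : forall c, 0 <= dotc c (K' *m c).
Hypothesis ext_psd : forall c, 0 <= kappa + 2 * dotc c v + dotc c (K *m c).
(** Says that [K'] is [K] bordered by [v] and [kappa], through its action on appended vectors; block
    matrices would have size t + 1 instead of [t.+1] and require casts. *)
Hypothesis K'_mul : forall c r,
  K' *m rcons_col c r = rcons_col (K *m c + r *: v) (dotc v c + r * kappa).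

Lemma ridge_energy_rcons l u r : 0 < l ->
  let m := dotc v (invmx (K + l%:M) *m u) in
  let pv := kappa - dotc v (invmx (K + l%:M) *m v) in
  ridge_energy K' l (rcons_col u r) =
  ridge_energy K l u + r ^+ 2 - l * (r - m) ^+ 2 / (pv + l).
Proof.
move=> l0 m pv; rewrite /ridge_energy.
have pv0 : 0 <= pv by exact: (ridge_var_ge0 K_sym K_psd ext_psd l0).
pose c := invmx (K + l%:M) *m u; pose a := invmx (K + l%:M) *m v.
have e : K *m c + l *: c = u := ridge_solve K_sym K_psd u l0.
have e' : K *m a + l *: a = v := ridge_solve K_sym K_psd v l0.
(* Last coordinate of the solution of the bordered system: the innovation r - m divided by the Schur
   complement pv + l. The other coordinates are then [c - s *: a]. *)
pose s := (r - m) / (pv + l).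
rewrite -[invmx (K + _) *m _]/c.
have -> : invmx (K' + l%:M) *m rcons_col u r = rcons_col (c - s *: a) s.
  apply: (canLR (mulKmx (ridge_unit K'_sym K'_psd l0))).
  rewrite ridge_mul K'_mul.
  have -> : u = K *m (c - s *: a) + s *: v + l *: (c - s *: a).
    rewrite mulmxBr -scalemxAr scalerBr -{1}e -e' scalerDr.
    by rewrite !scalerA (mulrC l s); apply/matrixP => i j; rewrite !mxE; ring.
  apply/matrixP => i j; rewrite !mxE; case: unliftP => [i' _|_].
    by rewrite !mxE.
  rewrite dotcDr dotcNr dotcZr -/m /s -/pv.
  have : pv = kappa - dotc v a by [].
  move: (dotc v a) => w; move=> hpv; have -> : w = kappa - pv by lra.
  by field; rewrite gt_eqF// ltr_wpDl.
rewrite !dotc_rcons dotcDr dotcNr dotcZr.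
have -> : dotc u a = m by rewrite /m -/c {1}/a (dotc_ridge_inv K_sym).
rewrite /s; field; rewrite gt_eqF// ltr_wpDl//.
Qed.

End RidgeExtension.

Section EnergyStep.
Variables (R : realType) (E : Type) (k : E -> E -> R) (Xs : set E).
Hypothesis k_sym : forall a b, Xs a -> Xs b -> k a b = k b a.
Hypothesis k_pd : pd_kernel k Xs.
Variable xs : nat -> E.
Hypothesis xsX : forall t, Xs (xs t.+1).

Lemma yvecS (ys : nat -> R) t : yvec ys t.+1 = rcons_col (yvec ys t) (ys t.+1).
Proof.
apply/matrixP => i j; rewrite !mxE.
case: unliftP => [i' ->|->]; last by [].
by rewrite mxE lift_max.
Qed.

Lemma gramS_mul t (c : 'cV[R]_t) r :
  gram k xs t.+1 *m rcons_col c r =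
  rcons_col (gram k xs t *m c + r *: kvec k xs t (xs t.+1))
    (dotc (kvec k xs t (xs t.+1)) c + r * k (xs t.+1) (xs t.+1)).
Proof.
apply/matrixP => i j; rewrite (ord1 j) !mxE big_ord_recr/=.
rewrite rcons_col_max; case: unliftP => [i' ->|->].
  rewrite !mxE lift_max (k_sym (xsX t))// (mulrC r); congr (_ + _).
  by apply: eq_bigr => h _; rewrite rcons_col_lift !mxE lift_max.
rewrite dotcE !mxE (mulrC r); congr (_ + _).
by apply: eq_bigr => h _; rewrite rcons_col_lift !mxE.
Qed.

Lemma fit_energyS (ys : nat -> R) l t : 0 < l ->
  fit_energy k xs ys l t.+1 = fit_energy k xs ys l t + ys t.+1 ^+ 2 -
    l * (ys t.+1 - post_mean k xs ys l t (xs t.+1)) ^+ 2 /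
    (post_var k xs l t (xs t.+1) + l).
Proof.
move=> l0; rewrite /fit_energy yvecS post_meanE post_varE.
apply: (ridge_energy_rcons (gram_sym k_sym xsX t) _ (gram_sym k_sym xsX t.+1))
  => //.
- exact: gram_psd k_pd _ xsX t.
- exact: gram_psd k_pd _ xsX t.+1.
- exact: (kvec_psd k_sym k_pd xsX (xsX t)).
- exact: gramS_mul.
Qed.

End EnergyStep.

(** * Measurability *)

Section KernelMeasurability.
Variables (R : realType) (E : topologicalType) (Xs : set E) (k : E -> E -> R).
Hypothesis Xs_compact : compact Xs.
Hypothesis k_cont : {within Xs `*` Xs, continuous (fun p : E * E => k p.1 p.2)}.
Hypothesis k_sym : forall a b, Xs a -> Xs b -> k a b = k b a.
Hypothesis k_pd : pd_kernel k Xs.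

(** Squared RKHS distance between k(a, .) and k(b, .). *)
Let kdist a b := k a a + k b b - 2 * k a b.

Lemma kernel_cvg_within (f g : E -> E) :
  (forall a, Xs a -> Xs (f a)) -> (forall a, Xs a -> Xs (g a)) ->
  {within Xs, continuous f} -> {within Xs, continuous g} ->
  {within Xs, continuous (fun a => k (f a) (g a))}.
Proof.
move=> fX gX /subspace_continuousP cf /subspace_continuousP cg.
have /subspace_continuousP kc := k_cont.
apply/subspace_continuousP => a aX.
have := kc (f a, g a) (conj (fX _ aX) (gX _ aX)).
apply: (@cvg_comp _ _ _ (fun a => (f a, g a)) (fun p : E * E => k p.1 p.2)).
move=> S; rewrite /within/= => hS.
have FF : Filter (within Xs (nbhs a)) by exact: within_filter.
have := cvg_pair (cf a aX) (cg a aX) hS.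
move=> /(_ FF (nbhs_filter _) (nbhs_filter _)).
rewrite /= /nbhs/= /within/=; apply: filterS => b + bX.
by move=> /(_ bX); apply; split; [exact: fX|exact: gX].
Qed.

Lemma kernel_cauchy_schwarz a b c : Xs a -> Xs b -> Xs c ->
  (k c a - k c b) ^+ 2 <= k c c * kdist a b.
Proof.
move=> aX bX cX.
have h1 : comb_in Xs [:: (1 : R, c)] by move=> q [<-|[]].
have h2 : comb_in Xs [:: (1 : R, a); (- 1, b)] by move=> q [<-|[<-|[]]].
have := comb_cauchy_schwarz k_sym k_pd h1 h2.
rewrite -sqrtrM ?k_pd// -sqrtr_sqr ler_sqrt; last first.
  by rewrite mulr_ge0 // k_pd.
rewrite /comb_inner /comb_sqnorm !(big_cons, big_nil)/= /kdist (k_sym bX aX).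
by move=> h; apply: le_trans (le_trans _ h) _; rewrite le_eqVlt; apply/orP;
  left; apply/eqP; ring.
Qed.

Lemma kernel_diag_cont : {within Xs, continuous (fun a => k a a)}.
Proof.
by apply: (@kernel_cvg_within id id) => //; apply: continuous_subspaceT => x.
Qed.

Lemma kernel_section_cont b : Xs b -> {within Xs, continuous (fun a => k a b)}.
Proof.
move=> bX; apply: (@kernel_cvg_within id (fun=> b)) => //.
  by apply: continuous_subspaceT => x.
exact: cst_continuous.
Qed.

Lemma kernel_net (e : R) : 0 < e -> exists s : seq E,
  (forall c, List.In c s -> Xs c) /\
  (forall a, Xs a -> exists2 c, List.In c s & kdist a c < e).
Proof.
move=> e0.
have /compact_near_coveringP cov := Xs_compact.
(* A property belongs to [F] when it holds for all lists containing some finite list of points of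
   [Xs]. Near-covering compactness along [F] merges the local nets, one centre each, into a single
   finite net. *)
pose F : set_system (seq E) := [set Q | exists s0 : seq E,
  (forall c, List.In c s0 -> Xs c) /\ forall s, List.incl s0 s -> Q s].
have FF : Filter F.
  split; first by exists [::].
  - move=> Q Q' [s [sX hs]] [s' [sX' hs']]; exists (s ++ s'); split.
      by move=> c h; case: (List.in_app_or _ _ _ h) => [/sX|/sX'].
    move=> s2 h; split; [apply: hs|apply: hs'] => c hc;
      apply: h; apply: List.in_or_app; [by left|by right].
  - by move=> Q Q' QQ' [s [sX hs]]; exists s; split => // s2 /hs /QQ'.
pose close s a := Xs a -> exists2 c, List.In c s & kdist a c < e.
have [|s [sX hs]] := cov _ F close FF.
  move=> c cX.
  have FX : Filter (within Xs (nbhs c)) by exact: within_filter.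
  have /subspace_continuousP/(_ c cX) h1 := kernel_diag_cont.
  have /subspace_continuousP/(_ c cX) h2 := kernel_section_cont cX.
  have : kdist a c @[a --> within Xs (nbhs c)] --> kdist c c.
    apply: (cvgB (cvgD h1 (cvg_cst (k c c)))).
    exact: (cvgM (cvg_cst (2 : R)) h2).
  move=> /cvgr_lt /(_ e).
  have -> : kdist c c = 0 by rewrite /kdist; ring.
  move=> /(_ e0); rewrite /= /nbhs/= /within => h.
  exists ([set a | Xs a -> kdist a c < e], [set s | List.In c s]) => /=.
    split => //; exists [:: c]; split; first by move=> ? [<-|[]].
    by move=> s; apply; left.
  by move=> [a s] /= [ha hs] aX; exists c => //; exact: ha.
exists s; split => // a aX.
by have /(_ a aX aX) := hs s (@List.incl_refl _ _).
Qed.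

Section Composition.
Context d (S : measurableType d).

Definition borel_map (X : S -> E) :=
  forall U, open U -> measurable (X @^-1` U).

Lemma measurable_within_comp (f : E -> R) (X : S -> E) :
  (forall w, Xs (X w)) -> borel_map X -> {within Xs, continuous f} ->
  measurable_fun [set: S] (f \o X).
Proof.
move=> XX mX /subspace_continuousP cf.
apply: (measurability _ (RGenOpens.measurableE R)).
move=> _ [_ [a [b ->] <-]]; rewrite setTI.
set V := `]a, b[%classic.
(* Continuity within [Xs] does not make the preimage of V under [f] open in E. Allowing all points
   outside [Xs] and taking the interior gives an open set with the same preimage under [X], because
   [X] stays in [Xs]. *)
rewrite (_ : _ @^-1` _ = X @^-1` ([set c | Xs c -> V (f c)]^°)).
  by apply: mX; exact: open_interior.
apply/seteqP; split => w /=; last by move=> /interior_subset; apply.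
move=> h; have nV : nbhs (f (X w)) V.
  by apply: open_nbhs_nbhs; split => //; exact: interval_open.
by have /= := cf _ (XX w) V nV; rewrite /nbhs.
Qed.

Lemma measurable_kernel_l (X : S -> E) b : (forall w, Xs (X w)) ->
  borel_map X -> Xs b -> measurable_fun [set: S] (fun w => k (X w) b).
Proof.
move=> XX mX bX.
by apply: (@measurable_within_comp (fun a => k a b)) => //; exact: kernel_section_cont.
Qed.

Lemma measurable_kernel_diag (X : S -> E) : (forall w, Xs (X w)) ->
  borel_map X -> measurable_fun [set: S] (fun w => k (X w) (X w)).
Proof.
move=> XX mX.
by apply: (@measurable_within_comp (fun a => k a a)) => //; exact: kernel_diag_cont.
Qed.

(* The topology of E need not be second countable, so joint continuity of k does
   not give joint measurability. Instead Y is replaced by a nearby point of a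
   finite net of Xs in the kernel pseudometric. *)
Lemma measurable_pd_kernel (X Y : S -> E) :
  (forall w, Xs (X w)) -> (forall w, Xs (Y w)) -> borel_map X -> borel_map Y ->
  measurable_fun [set: S] (fun w => k (X w) (Y w)).
Proof.
move=> XX YX mX mY.
(* A measurable selection: the first net point within [e] of [a]. The default is later the value of
   [X] at some [w0], so that it lies in [Xs]; this is why an empty [S] is treated apart. *)
pose fix near_pt (e : R) c0 (s : seq E) a {struct s} :=
  if s is c :: s' then if kdist a c < e then c else near_pt e c0 s' a else c0.
have [[w0]|S0] := pselect (inhabited S); last first.
  move=> _ B _; rewrite (_ : _ `&` _ = set0)//.
  by apply/seteqP; split => // w; case: S0.
have e0 n : 0 < n.+1%:R^-1 :> R by rewrite invr_gt0.
have [s hs] := choice (fun n => kernel_net (e0 n)).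
pose h n w := k (X w) (near_pt n.+1%:R^-1 (X w0) (s n) (Y w)).
apply: (@measurable_fun_cvg _ _ _ _ h).
- move=> n; rewrite /h; have := (hs n).1; elim: (s n) => [|c s' ih] hc /=.
    exact: measurable_kernel_l.
  have cX : Xs c by apply: hc; left.
  rewrite (_ : (fun _ => _) = (fun w => if kdist (Y w) c < n.+1%:R^-1
    then k (X w) c else k (X w) (near_pt n.+1%:R^-1 (X w0) s' (Y w)))); last first.
    by apply/funext => w; case: ifP.
  apply: measurable_fun_ifT.
  + apply: measurable_fun_ltr => //; rewrite /kdist.
    apply: measurable_funB; last first.
      by apply: measurable_funM => //; exact: measurable_kernel_l.
    by apply: measurable_funD => //; exact: measurable_kernel_diag.
  + exact: measurable_kernel_l.
  + by apply: ih => q hq; apply: hc; right.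
- move=> w _.
  have hn n : (h n w - k (X w) (Y w)) ^+ 2 <= k (X w) (X w) / n.+1%:R.
    rewrite /h; set c := near_pt _ _ _ _.
    have [cX dc] : Xs c /\ kdist (Y w) c < n.+1%:R^-1.
      have [c1 c1s dc1] := (hs n).2 _ (YX w).
      rewrite /c; have := (hs n).1; elim: (s n) c1s => [//|b s' ih] /= h1 h2.
      have [h3|h3] := boolP (kdist (Y w) b < _); first by split => //; apply: h2; left.
      case: h1 => [bc|h1]; first by rewrite bc dc1 in h3.
      by apply: ih => // q hq; apply: h2; right.
    rewrite -sqrrN opprB.
    apply: le_trans (kernel_cauchy_schwarz (YX w) cX (XX w)) _.
    apply: ler_wpM2l; last exact: ltW.
    have := k_pd (s := [:: (1, X w)]).
    rewrite /comb_sqnorm !big_cons !big_nil/= !addr0 !mul1r; apply.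
    by move=> q [<-|[]]//; exact: XX.
  apply/cvgrPdist_le => e ep.
  have cv : (fun n => k (X w) (X w) / n.+1%:R) @ \oo --> (0 : R).
    rewrite -[X in _ --> X](mulr0 (k (X w) (X w))).
    by apply: cvgM; [exact: cvg_cst|exact: cvg_harmonic].
  have /cvgr_le /(_ (e ^+ 2)) := cv; rewrite exprn_gt0// => /(_ isT).
  apply: filterS => n /(le_trans (hn n)).
  by rewrite -sqrrN opprB -[X in X <= _]real_normK ?num_real// ler_pXn2r// nnegrE ?(ltW ep).
Qed.

(** Measurability of [f] along [X] comes from membership in the RKHS alone: [f] is a pointwise limit
    on [Xs] of finite combinations of kernel sections. *)
Lemma measurable_rkhs f B (X : S -> E) : rkhs_norm_is k Xs f B ->
  (forall w, Xs (X w)) -> borel_map X -> measurable_fun [set: S] (f \o X).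
Proof.
move=> [g [gX _ gf _]] XX mX.
apply: (@measurable_fun_cvg _ _ _ _ (fun m w => comb_eval k (g m) (X w))).
  move=> m; rewrite /comb_eval; elim: (g m) (gX m) => [|q s ih] hs.
    by under eq_fun do rewrite big_nil; exact: measurable_cst.
  under eq_fun do rewrite big_cons.
  have qX : Xs q.2 by apply: hs; left.
  apply: measurable_funD; last by apply: ih => q' hq'; apply: hs; right.
  apply: measurable_funM => //.
  under eq_fun do rewrite (k_sym qX (XX _)).
  exact: measurable_kernel_l.
by move=> w _; exact: gf.
Qed.

End Composition.
End KernelMeasurability.

(** * Measurability of matrix operations and of the ridge quantities *)

Section MatrixMeasurability.
Context d (S : measurableType d) (R : realType).

Definition mx_measurable m n (A : S -> 'M[R]_(m, n)) :=
  forall i j, measurable_fun [set: S] (fun w => A w i j).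

Lemma measurable_inv (f : S -> R) : measurable_fun [set: S] f ->
  measurable_fun [set: S] (fun w => (f w)^-1).
Proof.
move=> mf.
(* The real power computes an inverse on nonnegative reals, hence the square; the factor [f w]
   restores the sign and gives 0 at the zeros of [f], in agreement with the convention for the
   inverse of 0. *)
rewrite (_ : (fun _ => _) = (fun w => f w * ((f w ^+ 2) `^ (- 1)))).
  apply: measurable_funM => //.
  apply: (measurableT_comp (measurable_powR _)); exact: measurable_funX.
apply/funext => w; rewrite powR_inv1 ?sqr_ge0//.
have [->|f0] := eqVneq (f w) 0; first by rewrite invr0 mul0r.
by field.
Qed.

Lemma mx_measurable_mul m n p (A : S -> 'M[R]_(m, n)) (B : S -> 'M[R]_(n, p)) :
  mx_measurable A -> mx_measurable B -> mx_measurable (fun w => A w *m B w).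
Proof.
move=> mA mB i j; under eq_fun do rewrite mxE.
by apply: measurable_sum => h; apply: measurable_funM; [exact: mA|exact: mB].
Qed.

Lemma mx_measurable_tr m n (A : S -> 'M[R]_(m, n)) :
  mx_measurable A -> mx_measurable (fun w => (A w)^T).
Proof. by move=> mA i j; under eq_fun do rewrite mxE; exact: mA. Qed.

Lemma measurable_det n (A : S -> 'M[R]_n) : mx_measurable A ->
  measurable_fun [set: S] (fun w => \det (A w)).
Proof.
move=> mA; rewrite /determinant; apply: measurable_sum => s.
apply: measurable_funM => //; apply: measurable_prod => i _; exact: mA.
Qed.

Lemma mx_measurable_inv n (A : S -> 'M[R]_n) : mx_measurable A ->
  (forall w, A w \in unitmx) -> mx_measurable (fun w => invmx (A w)).
Proof.
move=> mA uA i j.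
rewrite (_ : (fun _ => _) = (fun w => (\det (A w))^-1 * cofactor (A w) j i)).
  apply: measurable_funM; first exact/measurable_inv/measurable_det.
  rewrite /cofactor; apply: measurable_funM => //; apply: measurable_det.
  by move=> i' j'; under eq_fun do rewrite !mxE; exact: mA.
by apply/funext => w; rewrite /invmx uA !mxE.
Qed.

End MatrixMeasurability.

Section RidgeMeasurability.
Variables (R : realType) (E : topologicalType) (Xs : set E) (k : E -> E -> R).
Hypothesis Xs_compact : compact Xs.
Hypothesis k_cont : {within Xs `*` Xs, continuous (fun p : E * E => k p.1 p.2)}.
Hypothesis k_sym : forall a b, Xs a -> Xs b -> k a b = k b a.
Hypothesis k_pd : pd_kernel k Xs.
Context d (S : measurableType d).
Variable x : nat -> S -> E.
Hypothesis xX : forall t w, Xs (x t.+1 w).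
Variables (l : R) (t : nat).
Hypothesis l0 : 0 < l.
Hypothesis x_meas : forall s, (s < t)%N -> borel_map (x s.+1).

Let mk := measurable_pd_kernel Xs_compact k_cont k_sym k_pd.

Lemma mx_measurable_ridge_inv :
  mx_measurable (fun w => invmx (gram k (x^~ w) t + l%:M)).
Proof.
apply: mx_measurable_inv.
  move=> i j; under eq_fun do rewrite !mxE.
  by apply: measurable_funD => //; apply: mk => //; exact: x_meas.
move=> w; apply: ridge_unit => //.
  exact: (gram_sym k_sym (xs := x^~ w) (fun s => xX s w)).
exact: (gram_psd k_pd (xs := x^~ w) (fun s => xX s w)).
Qed.

Lemma mx_measurable_kvec (z : S -> E) : (forall w, Xs (z w)) -> borel_map z ->
  mx_measurable (fun w => kvec k (x^~ w) t (z w)).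
Proof.
move=> zX mz i j; under eq_fun do rewrite !mxE.
by apply: mk => //; exact: x_meas.
Qed.

Lemma mx_measurable_yvec (ys : nat -> S -> R) :
  (forall s, (s < t)%N -> measurable_fun [set: S] (ys s.+1)) ->
  mx_measurable (fun w => yvec (ys^~ w) t).
Proof. by move=> my i j; under eq_fun do rewrite !mxE; exact: my. Qed.

Lemma measurable_post_mean (ys : nat -> S -> R) (z : S -> E) :
  (forall s, (s < t)%N -> measurable_fun [set: S] (ys s.+1)) ->
  (forall w, Xs (z w)) -> borel_map z ->
  measurable_fun [set: S] (fun w => post_mean k (x^~ w) (ys^~ w) l t (z w)).
Proof.
move=> my zX mz; have mv := mx_measurable_kvec zX mz.
have mi := mx_measurable_ridge_inv.
exact: (mx_measurable_mul (mx_measurable_mul (mx_measurable_tr mv) mi)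
  (mx_measurable_yvec my)).
Qed.

Lemma measurable_post_var (z : S -> E) :
  (forall w, Xs (z w)) -> borel_map z ->
  measurable_fun [set: S] (fun w => post_var k (x^~ w) l t (z w)).
Proof.
move=> zX mz; have mv := mx_measurable_kvec zX mz.
have mi := mx_measurable_ridge_inv.
apply: measurable_funB; first exact: mk.
exact: (mx_measurable_mul (mx_measurable_mul (mx_measurable_tr mv) mi) mv).
Qed.

Lemma measurable_fit_energy (ys : nat -> S -> R) :
  (forall s, (s < t)%N -> measurable_fun [set: S] (ys s.+1)) ->
  measurable_fun [set: S] (fun w => fit_energy k (x^~ w) (ys^~ w) l t).
Proof.
move=> my; have {}my := mx_measurable_yvec my.
have mi := mx_measurable_ridge_inv.
apply: measurable_funB.
  exact: (mx_measurable_mul (mx_measurable_tr my) my).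
apply: measurable_funM => //.
exact: (mx_measurable_mul (mx_measurable_tr my) (mx_measurable_mul mi my)).
Qed.

End RidgeMeasurability.

Lemma info_gainS (R : realType) (E : Type) (k : E -> E -> R) xs l t :
  info_gain k xs l t.+1 = info_gain k xs l t +
    2^-1 * ln (1 + post_var k xs l t (xs t.+1) / l).
Proof. by rewrite /info_gain big_nat_recr//= mulrDr. Qed.

Lemma info_gain0 (R : realType) (E : Type) (k : E -> E -> R) xs l :
  info_gain k xs l 0 = 0.
Proof. by rewrite /info_gain big_nil mulr0. Qed.

Section InfoGainMeasurability.
Variables (R : realType) (E : topologicalType) (Xs : set E) (k : E -> E -> R).
Hypothesis Xs_compact : compact Xs.
Hypothesis k_cont : {within Xs `*` Xs, continuous (fun p : E * E => k p.1 p.2)}.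
Hypothesis k_sym : forall a b, Xs a -> Xs b -> k a b = k b a.
Hypothesis k_pd : pd_kernel k Xs.
Context d (S : measurableType d).
Variable x : nat -> S -> E.
Hypothesis xX : forall t w, Xs (x t.+1 w).

Lemma measurable_info_gain (l : R) (t : nat) : 0 < l ->
  (forall s, (s < t)%N -> borel_map (x s.+1)) ->
  measurable_fun [set: S] (fun w => info_gain k (x^~ w) l t).
Proof.
move=> l0; elim: t => [|t ih] mx.
  by under eq_fun do rewrite info_gain0; exact: measurable_cst.
under eq_fun do rewrite info_gainS.
apply: measurable_funD; first by apply: ih => s st; apply: mx; exact: ltnW.
apply: measurable_funM => //; apply: (measurableT_comp (@measurable_ln R)).
apply: measurable_funD => //; apply: measurable_funM => //.
apply: (measurable_post_var Xs_compact k_cont k_sym k_pd xX l0) => //.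
  by move=> s st; apply: mx; exact: ltnW.
exact: mx.
Qed.

End InfoGainMeasurability.

(** * Sub-Gaussian noise with predictable exponents *)

Section Truncation.
Variable R : realType.

(* [round0 n r / (n + 1)] is r rounded towards zero, so it never exceeds r in
   absolute value. *)
Definition round0 n (r : R) : int :=
  if 0 <= r then Num.floor (n.+1%:R * r) else Num.ceil (n.+1%:R * r).

Lemma round0_le n : {homo round0 n : r s / r <= s}.
Proof.
move=> r s rs; rewrite /round0; have [r0|r0] := leP 0 r.
  by rewrite (le_trans r0 rs) le_floor// ler_pM2l.
have [s0|s0] := leP 0 s; last by rewrite le_ceil// ler_pM2l.
apply: (@le_trans _ _ 0).
  by rewrite ceil_le0 nmulr_lle0 // ?ltW //; rewrite pmulr_rle0// ltW.
by rewrite floor_ge0 mulr_ge0.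
Qed.

Lemma measurable_round0 n i : measurable [set r : R | round0 n r = i].
Proof.
have : measurable_fun [set: R] (fun r => (round0 n r)%:~R : R).
  apply: nondecreasing_measurable => // r s rs.
  by rewrite ler_int round0_le.
move=> /(_ measurableT [set i%:~R] (measurable_set1 _)); rewrite setTI.
congr (measurable _); apply/seteqP; split => r /=.
  by move/intr_inj.
by move=> ->.
Qed.

Lemma round0_norm_le n r : `|(round0 n r)%:~R / n.+1%:R| <= `|r|.
Proof.
rewrite normrM normfV ler_pdivrMr// ?normr_gt0// (ger0_norm (ler0n _ n.+1)).
rewrite /round0; have [r0|r0] := leP 0 r.
  rewrite !ger0_norm// ?(mulrC r) ?floor_le//.
  by rewrite ler0z floor_ge0 mulr_ge0.
rewrite !ler0_norm// ?(ltW r0)//; last first.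
  by rewrite lerz0 ceil_le0 pmulr_rle0// ltW.
by rewrite mulNr lerN2 (mulrC r) ceil_ge.
Qed.

Lemma round0_ge0 n r : 0 <= r -> 0 <= (round0 n r)%:~R / n.+1%:R :> R.
Proof.
move=> r0; rewrite divr_ge0//.
by rewrite /round0 r0 ler0z floor_ge0 mulr_ge0.
Qed.

Lemma round0_cvg r : (fun n => (round0 n r)%:~R / n.+1%:R) @ \oo --> r.
Proof.
apply/cvgrPdist_le => e e0.
have /cvgr_le/(_ _ e0) := @cvg_harmonic R; apply: filterS => n.
apply: le_trans; rewrite /harmonic.
have -> : r - (round0 n r)%:~R / n.+1%:R = (n.+1%:R * r - (round0 n r)%:~R) / n.+1%:R.
  by rewrite mulrBl mulrAC divff// mul1r.
rewrite normrM normfV (ger0_norm (ler0n _ n.+1)) ler_pdivrMr// mulVf// /round0.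
case: ifP => _.
  have /andP[h1 h2] := floor_itv (n.+1%:R * r); rewrite ger0_norm ?subr_ge0//.
  by move: h2; rewrite intrD; lra.
have /andP[h1 h2] := ceil_itv (n.+1%:R * r); rewrite ler0_norm ?subr_le0//.
by move: h1; rewrite intrB; lra.
Qed.

End Truncation.

Lemma measurable_fun_nat d (T : measurableType d) (phi : T -> nat) :
  (forall n, measurable (phi @^-1` [set n])) -> measurable_fun [set: T] phi.
Proof.
move=> mphi _ B _; rewrite setTI.
rewrite (_ : phi @^-1` B = \bigcup_(n in B) (phi @^-1` [set n])).
  exact: bigcup_measurable.
apply/seteqP; split => w /=; first by exists (phi w).
by move=> [n Bn] /= ->.
Qed.

Section AtomComparison.
Context d (T : measurableType d) (R : realType).
Variable mu : {measure set T -> \bar R}.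
Local Open Scope ereal_scope.

Lemma ge0_le_integral_atoms (phi : T -> nat) (f g : T -> \bar R) :
  (forall n, measurable (phi @^-1` [set n])) ->
  measurable_fun setT f -> measurable_fun setT g ->
  (forall w, 0 <= f w) -> (forall w, 0 <= g w) ->
  (forall n, \int[mu]_(w in phi @^-1` [set n]) f w <=
             \int[mu]_(w in phi @^-1` [set n]) g w) ->
  \int[mu]_w f w <= \int[mu]_w g w.
Proof.
move=> mphi mf mg f0 g0 fg.
have e : [set: T] = \bigcup_n (phi @^-1` [set n]).
  by apply/seteqP; split => // w _; exists (phi w).
have tri : trivIset setT (fun n => phi @^-1` [set n]).
  by apply/trivIsetP => i j _ _ ij; apply/seteqP; split => // w /= [-> ji]; rewrite ji eqxx in ij.
rewrite e in mf mg *.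
rewrite !ge0_integral_bigcup//.
by apply: lee_nneseries => n *; [exact: integral_ge0|exact: fg].
Qed.

End AtomComparison.

Section RandomExponent.
Context d (T : measurableType d) (R : realType) (P : probability T R).
Variables (G : set (set T)) (xi : T -> R) (sigma : R).
Hypothesis G_sigma : sigma_algebra setT G.
Hypothesis G_meas : forall A, G A -> measurable A.
Hypothesis xi_meas : measurable_fun [set: T] xi.
Hypothesis xi_subg : forall (u : R) (A : set T), G A ->
  (\int[P]_(w in A) (expR (u * xi w))%:E <=
   (expR (u ^+ 2 * sigma ^+ 2 / 2))%:E * P A)%E.

Local Notation GT := (g_sigma_algebraType G).

(** [GT] is T carrying the sigma-algebra generated by [G]. As [G] is already one, nothing is added,
    and measurability with respect to the past becomes ordinary measurability on [GT]. *)
Lemma g_sigma_measurableE (A : set T) : measurable (A : set GT) <-> G A.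
Proof. by rewrite -[X in _ <-> X A](measurable_g_measurableTypeE G_sigma). Qed.

Lemma g_sigma_measurable_fun d' (S : measurableType d') (f : T -> S) :
  measurable_fun [set: GT] f -> measurable_fun [set: T] f.
Proof.
move=> mf _ B mB; rewrite setTI; apply: G_meas; apply/g_sigma_measurableE.
by have := mf measurableT B mB; rewrite setTI.
Qed.

(** On each level set of [phi] the exponent and the weight are constant and the level set is in [G],
    so the hypothesis with that constant applies there; the pieces are then summed. *)
Lemma subgaussian_countable_exponent (phi : T -> nat) (u z : nat -> R) :
  (forall n, G (phi @^-1` [set n])) -> (forall n, 0 <= z n) ->
  (\int[P]_w (z (phi w) * expR (u (phi w) * xi w))%:E <=
   \int[P]_w (z (phi w) * expR ((u (phi w)) ^+ 2 * sigma ^+ 2 / 2))%:E)%E.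
Proof.
move=> Gphi z0.
have mphi : measurable_fun [set: T] phi.
  by apply: measurable_fun_nat => n; exact/G_meas.
have mu' : measurable_fun [set: T] (u \o phi).
  exact: (measurableT_comp (f := u)).
have mz : measurable_fun [set: T] (z \o phi) by exact: (measurableT_comp (f := z)).
apply: (ge0_le_integral_atoms (phi := phi)).
- by move=> n; exact/G_meas.
- apply/measurable_EFinP; apply: measurable_funM => //.
  by apply: (measurableT_comp (@measurable_expR R)); exact: measurable_funM.
- apply/measurable_EFinP; apply: measurable_funM => //.
  apply: (measurableT_comp (@measurable_expR R)).
  by do 2 apply: measurable_funM => //; exact: measurable_funX.
- by move=> w; rewrite lee_fin mulr_ge0// expR_ge0.
- by move=> w; rewrite lee_fin mulr_ge0// expR_ge0.
- move=> n; have mA := G_meas (Gphi n).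
  rewrite (eq_integral (fun w => (z n)%:E * (expR (u n * xi w))%:E)%E); last first.
    by move=> w; rewrite inE/= => ->; rewrite EFinM.
  rewrite [leRHS](eq_integral (fun w => (z n * expR (u n ^+ 2 * sigma ^+ 2 / 2))%:E)%E); last first.
    by move=> w; rewrite inE/= => ->.
  rewrite ge0_integralZl_EFin//; last first.
    apply/measurable_EFinP; apply: (measurableT_comp (@measurable_expR R)).
    by apply: measurable_funTS; exact: measurable_funM.
  rewrite [leRHS](integral_cst P mA) EFinM -muleA; apply: lee_wpmul2l.
    by rewrite lee_fin.
  exact: xi_subg.
Qed.

(* Discretise U and Z by values constant on countably many atoms of G, then
   use Fatou; no domination is needed since |U_n| <= |U| and Z_n <= Z. *)
Lemma subgaussian_random_exponent (U Z : T -> R) :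
  measurable_fun [set: GT] U -> measurable_fun [set: GT] Z ->
  (forall w, 0 <= Z w) ->
  (\int[P]_w (Z w * expR (U w * xi w))%:E <=
   \int[P]_w (Z w * expR ((U w) ^+ 2 * sigma ^+ 2 / 2))%:E)%E.
Proof.
move=> mU mZ Z0.
have mU' := g_sigma_measurable_fun mU; have mZ' := g_sigma_measurable_fun mZ.
(* Both rounded values are coded in one natural number, so that one countable partition makes
   exponent and weight constant together. *)
pose phi n w : nat := pickle (round0 n (U w), round0 n (Z w)).
pose dec n : int * int := odflt (0, 0) (unpickle n).
pose u n i : R := (dec i).1%:~R / n.+1%:R.
(* The maximum with 0 keeps the weight nonnegative at every code, including those never attained; at
   attained codes it changes nothing. *)
pose z n i : R := Num.max 0 ((dec i).2%:~R / n.+1%:R).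
have uE n w : u n (phi n w) = (round0 n (U w))%:~R / n.+1%:R.
  by rewrite /u /dec /phi pickleK.
have zE n w : z n (phi n w) = (round0 n (Z w))%:~R / n.+1%:R.
  by rewrite /z /dec /phi pickleK/= max_r// round0_ge0.
have Gphi n i : G (phi n @^-1` [set i]).
  apply/g_sigma_measurableE.
  have [[[a b] ab]|no] := pselect (exists p : int * int, pickle p = i).
    rewrite (_ : _ @^-1` _ = U @^-1` [set r | round0 n r = a] `&`
      Z @^-1` [set r | round0 n r = b]).
      apply: measurableI.
        by have := mU measurableT _ (measurable_round0 n a); rewrite setTI.
      by have := mZ measurableT _ (measurable_round0 n b); rewrite setTI.
    apply/seteqP; split => w /=.
      by rewrite -ab => /(pcan_inj pickleK)[].
    by move=> [ha hb]; rewrite -ab /phi ha hb.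
  rewrite (_ : _ @^-1` _ = set0)//.
  apply/seteqP; split => // w /= h; apply: no; eexists; exact: h.
pose f n w : \bar R := (z n (phi n w) * expR (u n (phi n w) * xi w))%:E.
have mphi n i : measurable_fun [set: T] (fun w => (i (phi n w)) : R).
  apply: (measurableT_comp (f := i)) => //.
  by apply: measurable_fun_nat => j; exact/G_meas.
have z0 n i : 0 <= z n i by rewrite /z le_max lexx.
have mf n : measurable_fun [set: T] (f n).
  apply/measurable_EFinP; apply: measurable_funM => //.
  by apply: (measurableT_comp (@measurable_expR R)); exact: measurable_funM.
have f0 n w : [set: T] w -> (0 <= f n w)%E.
  by move=> _; rewrite lee_fin mulr_ge0// expR_ge0.
have := fatou P measurableT mf f0.
rewrite (eq_integral (fun w => (Z w * expR (U w * xi w))%:E)); last first.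
  move=> w _; apply: (cvg_limn_einf_sup _).1.
  apply/cvg_EFin; first by apply: nearW.
  apply: cvgM.
    by under eq_cvg do rewrite /= zE; exact: round0_cvg.
  apply: continuous_cvg; first exact: continuous_expR.
  apply: cvgM; last exact: cvg_cst.
  by under eq_cvg do rewrite uE; exact: round0_cvg.
move=> /le_trans; apply.
set C := (X in (_ <= X)%E).
have fC n : (\int[P]_w f n w <= C)%E.
  apply: (le_trans (subgaussian_countable_exponent (u n) (Gphi n) (z0 n))).
  apply: ge0_le_integral => //.
  - by move=> w _; rewrite lee_fin mulr_ge0// expR_ge0.
  - apply/measurable_EFinP; apply: measurable_funM => //.
    apply: (measurableT_comp (@measurable_expR R)).
    by do 2 apply: measurable_funM => //; exact: measurable_funX.
  - apply/measurable_EFinP; apply: measurable_funM => //.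
    apply: (measurableT_comp (@measurable_expR R)).
    by do 2 apply: measurable_funM => //; exact: measurable_funX.
  move=> w _; rewrite lee_fin ler_pM ?expR_ge0//.
    by rewrite zE; have := round0_norm_le n (Z w); rewrite !ger0_norm ?round0_ge0.
  rewrite ler_expR ler_pM2r// ler_wpM2r ?sqr_ge0//.
  rewrite uE -(real_normK (num_real (U w))) -[leLHS]real_normK ?num_real//.
  by rewrite ler_pXn2r ?nnegrE ?normr_ge0// round0_norm_le.
rewrite limn_einf_lim; apply: lime_le.
  apply: is_cvg_einfs.
apply: nearW => n; apply: le_trans (fC n).
by apply: ereal_inf_lbound; exists n => /=.
Qed.

End RandomExponent.

(** * Gaussian mixtures of the sub-Gaussian bound *)

Lemma gaussian_quadratic_mgf (R : realType) (b c : R) : c < 1 ->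
  (\int[lebesgue_measure]_g
     (normal_pdf 0 1 g * expR (b * g + c * g ^+ 2 / 2))%:E =
   ((Num.sqrt (1 - c))^-1 * expR (b ^+ 2 / (2 * (1 - c))))%:E)%E.
Proof.
move=> c1; have c0 : 0 < 1 - c by rewrite subr_gt0.
pose s := (Num.sqrt (1 - c))^-1.
have s0 : 0 < s by rewrite invr_gt0 sqrtr_gt0.
have s2 : s ^+ 2 = (1 - c)^-1 by rewrite exprVn sqr_sqrtr// ltW.
pose K := s * expR (b ^+ 2 / (2 * (1 - c))).
have K0 : 0 <= K by rewrite mulr_ge0 ?expR_ge0 ?(ltW s0).
(* Completing the square: the integrand is the constant [K] times the normal density with mean b /
   (1 - c) and variance 1 / (1 - c). *)
have e g : normal_pdf 0 1 g * expR (b * g + c * g ^+ 2 / 2) =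
    K * normal_pdf (b / (1 - c)) s g.
  rewrite !normal_pdfE ?gt_eqF// /normal_peak /normal_fun /K.
  have -> : Num.sqrt (s ^+ 2 * pi *+ 2) = s * Num.sqrt (1 ^+ 2 * pi *+ 2).
    rewrite -mulrnAr expr1n mul1r sqrtrM ?sqr_ge0// sqrtr_sqr gtr0_norm//.
  set q := Num.sqrt _; have q0 : q != 0.
    by rewrite gt_eqF// sqrtr_gt0 expr1n mul1r mulrn_wgt0// pi_gt0.
  rewrite -[LHS]mulrA -expRD.
  rewrite (_ : s * _ * _ = q^-1 * (expR (b ^+ 2 / (2 * (1 - c))) *
      expR (- (g - b / (1 - c)) ^+ 2 / (s ^+ 2 *+ 2)))); last first.
    by rewrite invfM; field; rewrite q0 gt_eqF.
  rewrite -expRD; congr (_ * expR _).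
  by rewrite s2; field; rewrite gt_eqF.
under eq_integral do rewrite e EFinM.
rewrite ge0_integralZl_EFin//.
- by rewrite integral_normal_pdf mule1.
- by move=> g _; rewrite lee_fin normal_pdf_ge0.
- by apply/measurable_EFinP; exact: measurable_normal_pdf.
Qed.

Section Mixture.
Context d (T : measurableType d) (R : realType) (P : probability T R).
Variables (G : set (set T)) (xi : T -> R) (sigma : R).
Hypothesis G_sigma : sigma_algebra setT G.
Hypothesis G_meas : forall A, G A -> measurable A.
Hypothesis xi_meas : measurable_fun [set: T] xi.
Hypothesis xi_subg : forall (u : R) (A : set T), G A ->
  (\int[P]_(w in A) (expR (u * xi w))%:E <=
   (expR (u ^+ 2 * sigma ^+ 2 / 2))%:E * P A)%E.

Local Notation GT := (g_sigma_algebraType G).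

(* Averaging exp(u xi) over u = m + s g with g standard Gaussian gives
   exp(m xi + s^2 xi^2 / 2). *)
Lemma subgaussian_mixture (m s Z : T -> R) :
  measurable_fun [set: GT] m -> measurable_fun [set: GT] s ->
  measurable_fun [set: GT] Z -> (forall w, 0 <= Z w) ->
  (forall w, s w ^+ 2 * sigma ^+ 2 < 1) ->
  (\int[P]_w (Z w * expR (m w * xi w + s w ^+ 2 * xi w ^+ 2 / 2))%:E <=
   \int[P]_w (Z w * ((Num.sqrt (1 - s w ^+ 2 * sigma ^+ 2))^-1 *
      expR (m w ^+ 2 * sigma ^+ 2 / (2 * (1 - s w ^+ 2 * sigma ^+ 2)))))%:E)%E.
Proof.
move=> mm ms mZ Z0 s1.
have mm' := g_sigma_measurable_fun G_sigma G_meas mm.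
have ms' := g_sigma_measurable_fun G_sigma G_meas ms.
have mZ' := g_sigma_measurable_fun G_sigma G_meas mZ.
pose F (p : T * R) : \bar R := (Z p.1 * normal_pdf 0 1 p.2 *
  expR ((m p.1 + s p.1 * p.2) * xi p.1))%:E.
pose F2 (p : T * R) : \bar R := (Z p.1 * normal_pdf 0 1 p.2 *
  expR ((m p.1 + s p.1 * p.2) ^+ 2 * sigma ^+ 2 / 2))%:E.
have fst_comp (h : T -> R) : measurable_fun [set: T] h ->
    measurable_fun [set: T * R] (fun p : T * R => h p.1).
  by move=> mh; apply: measurableT_comp.
have m1 : measurable_fun [set: T * R]
    (fun p : T * R => Z p.1 * normal_pdf 0 1 p.2).
  apply: measurable_funM; first exact: fst_comp.
  apply: (measurableT_comp (@measurable_normal_pdf R 0 1)).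
  exact: measurable_snd.
have m2 : measurable_fun [set: T * R] (fun p : T * R => m p.1 + s p.1 * p.2).
  apply: measurable_funD; first exact: fst_comp.
  by apply: measurable_funM; [exact: fst_comp|exact: measurable_snd].
have mF : measurable_fun setT F.
  apply/measurable_EFinP; apply: measurable_funM => //.
  apply: (measurableT_comp (@measurable_expR R)); apply: measurable_funM => //.
  exact: fst_comp.
have mF2 : measurable_fun setT F2.
  apply/measurable_EFinP; apply: measurable_funM => //.
  apply: (measurableT_comp (@measurable_expR R)).
  by do 2 apply: measurable_funM => //; exact: measurable_funX.
have F0 p : (0 <= F p)%E.
  by rewrite lee_fin !mulr_ge0 ?expR_ge0 ?normal_pdf_ge0.
have F20 p : (0 <= F2 p)%E.
  by rewrite lee_fin !mulr_ge0 ?expR_ge0 ?normal_pdf_ge0.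
have mpdf (b c : R) : measurable_fun [set: R]
    (fun g => (normal_pdf 0 1 g * expR (b * g + c * g ^+ 2 / 2))%:E).
  apply/measurable_EFinP; apply: measurable_funM.
    exact: measurable_normal_pdf.
  apply: (measurableT_comp (@measurable_expR R)).
  apply: measurable_funD; first exact: measurable_funM.
  by do 2 apply: measurable_funM => //; exact: measurable_funX.
have pdf0 (b c : R) g : (0 <= (normal_pdf 0 1 g *
    expR (b * g + c * g ^+ 2 / 2))%:E)%E.
  by rewrite lee_fin mulr_ge0 ?expR_ge0 ?normal_pdf_ge0.
rewrite (eq_integral (fun w => \int[lebesgue_measure]_g F (w, g))%E); last first.
  move=> w _; rewrite /F/=.
  under eq_integral => g _.
    rewrite (_ : _ * _ * _ = (Z w * expR (m w * xi w)) * (normal_pdf 0 1 g *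
      expR (s w * xi w * g + 0 * g ^+ 2 / 2))); last first.
      rewrite -!mulrA; congr (_ * _); rewrite [RHS]mulrCA; congr (_ * _).
      by rewrite -expRD; congr expR; ring.
    rewrite EFinM; over.
  rewrite ge0_integralZl_EFin ?mulr_ge0 ?expR_ge0//; last exact: mpdf.
  rewrite gaussian_quadratic_mgf// -EFinM; congr EFin.
  rewrite subr0 sqrtr1 invr1 mul1r -[RHS]mulrA -expRD; congr (_ * expR _).
  by field.
rewrite [leRHS](eq_integral (fun w => \int[lebesgue_measure]_g F2 (w, g))%E);
  last first.
  move=> w _; rewrite /F2/=.
  have d0 : 0 < 1 - s w ^+ 2 * sigma ^+ 2 by rewrite subr_gt0.
  under eq_integral => g _.
    rewrite (_ : _ * _ * _ = (Z w * expR (m w ^+ 2 * sigma ^+ 2 / 2)) *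
      (normal_pdf 0 1 g * expR (m w * s w * sigma ^+ 2 * g +
         (s w ^+ 2 * sigma ^+ 2) * g ^+ 2 / 2))); last first.
      rewrite -!mulrA; congr (_ * _); rewrite [RHS]mulrCA; congr (_ * _).
      by rewrite -expRD; congr expR; field.
    rewrite EFinM; over.
  rewrite ge0_integralZl_EFin ?mulr_ge0 ?expR_ge0//; last exact: mpdf.
  rewrite gaussian_quadratic_mgf// -EFinM; congr EFin.
  rewrite -[RHS]mulrA; congr (_ * _); rewrite [RHS]mulrCA; congr (_ * _).
  by rewrite -expRD; congr expR; field; rewrite exprMn gt_eqF.
(* Tonelli moves the integral over g outside. For fixed g the exponent m + s g is [G]-measurable, so
   the bound for random exponents applies. *)
have h1 := fubini_tonelli (m1 := P) (m2 := lebesgue_measure) F mF F0.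
have h2 := fubini_tonelli (m1 := P) (m2 := lebesgue_measure) F2 mF2 F20.
rewrite [leLHS]h1 [leRHS]h2.
apply: ge0_le_integral => //.
- by move=> g _; apply: integral_ge0 => w _.
- exact: measurable_fun_fubini_tonelli_G.
- exact: measurable_fun_fubini_tonelli_G.
move=> g _; rewrite /F /F2/=.
apply: (subgaussian_random_exponent G_sigma G_meas xi_meas xi_subg
  (U := fun w => m w + s w * g) (Z := fun w => Z w * normal_pdf 0 1 g)).
- by apply: measurable_funD => //; apply: measurable_funM.
- by apply: measurable_funM.
- by move=> w; rewrite mulr_ge0 ?normal_pdf_ge0.
Qed.

End Mixture.

(** * Ville's inequality *)

Section Ville.
Context d (T : measurableType d) (R : realType) (P : probability T R).
Variables (H : nat -> set (set T)) (M : nat -> T -> R) (a : R).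
Hypothesis H_meas : forall t A, H t A -> measurable A.
Hypothesis H_low : forall t, H t [set w | forall s, (s <= t)%N -> M s w <= a].
Hypothesis M_meas : forall t, measurable_fun [set: T] (M t).
Hypothesis M_ge0 : forall t w, 0 <= M t w.
Hypothesis M_init : (\int[P]_w (M 0 w)%:E <= 1)%E.
Hypothesis M_step : forall t A, H t A ->
  (\int[P]_(w in A) (M t.+1 w)%:E <= \int[P]_(w in A) (M t w)%:E)%E.
Hypothesis a_gt0 : 0 < a.

Let low t := [set w | forall s, (s <= t)%N -> M s w <= a].

Let low_meas t : measurable (low t). Proof. exact/H_meas/H_low. Qed.

(** Markov's inequality that keeps the integral over the part of [A] where [f] has not exceeded [a];
    that remainder is what the induction over time carries forward. *)
Lemma markov_split (A : set T) (f : T -> R) : measurable A ->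
  measurable_fun [set: T] f -> (forall w, 0 <= f w) ->
  (a%:E * P (A `&` [set w | (a < f w)%R]) +
     \int[P]_(w in A `&` [set w | (f w <= a)%R]) (f w)%:E <=
   \int[P]_(w in A) (f w)%:E)%E.
Proof.
move=> mA mf f0.
have m1 : measurable [set w | a < f w].
  rewrite (_ : [set _ | _] = f @^-1` `]a, +oo[).
    by rewrite -[_ @^-1` _]setTI; exact: mf.
  by apply/seteqP; split => w /=; rewrite in_itv/= andbT.
have e : [set w | f w <= a] = ~` [set w | a < f w].
  by apply/seteqP; split => w /=; rewrite leNgt => /negP.
have m2 : measurable [set w | f w <= a] by rewrite e; exact: measurableC.
have eA : A = (A `&` [set w | a < f w]) `|` (A `&` [set w | f w <= a]).
  by rewrite -setIUr e setUv setIT.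
have mfE (D : set T) : measurable_fun D (EFin \o f).
  by apply: measurable_funTS; exact/measurable_EFinP.
have disj : [disjoint A `&` [set w | a < f w] & A `&` [set w | f w <= a]].
  apply/disj_setPS => w [[_ h1] [_ h2]].
  by move: h1; rewrite /= ltNge h2.
have f0E w : ((A `&` [set w | a < f w]) `|` (A `&` [set w | f w <= a])) w ->
  (0 <= (EFin \o f) w)%E by rewrite lee_fin.
rewrite [leRHS](_ : _ = \int[P]_(w in (A `&` [set w | (a < f w)%R]) `|`
    (A `&` [set w | (f w <= a)%R])) (f w)%:E)%E; last by rewrite -eA.
rewrite (ge0_integral_setU P (measurableI _ _ mA m1) (measurableI _ _ mA m2)
  (mfE _) f0E disj).
apply: leeD => //.
rewrite -(integral_cst P (measurableI _ _ mA m1)).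
apply: ge0_le_integral => //.
- exact: measurableI.
- by move=> w _; rewrite lee_fin ltW.
- by move=> w [_ /= h]; rewrite lee_fin ltW.
Qed.

(* Optional stopping at the first crossing of a, without stopping times. *)
Lemma ville_finite t :
  (a%:E * P (~` low t) + \int[P]_(w in low t) (M t w)%:E <= 1)%E.
Proof.
elim: t => [|t ih].
  apply: le_trans M_init; have := markov_split measurableT (M_meas 0) (M_ge0 0).
  rewrite !setTI.
  have -> : [set w | a < M 0 w] = ~` low 0.
    apply/seteqP; split => w /=.
      by move=> h1 /(_ 0 isT); rewrite leNgt h1.
    by move=> h; rewrite ltNge; apply/negP => h2; apply: h => s; rewrite leqn0 => /eqP->.
  have -> // : [set w | M 0 w <= a] = low 0.
  apply/seteqP; split => w /=; last by apply.
  by move=> h s; rewrite leqn0 => /eqP->.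
apply: le_trans ih.
have mS := markov_split (low_meas t) (M_meas t.+1) (M_ge0 t.+1).
have e1 : ~` low t.+1 = ~` low t `|` (low t `&` [set w | a < M t.+1 w]).
  apply/seteqP; split => w /=.
    move=> h; have [lw|] := pselect (low t w); last by left.
    right; split => //; rewrite ltNge; apply/negP => h2; apply: h => s.
    by rewrite leq_eqVlt => /orP[/eqP->|]//; exact: lw.
  move=> [h|[_ h]] h2; first by apply: h => s st; apply: h2; exact: leqW.
  by have := h2 t.+1 (leqnn _); rewrite leNgt h.
have e2 : low t.+1 = low t `&` [set w | M t.+1 w <= a].
  apply/seteqP; split => w /=.
    by move=> h; split; [move=> s st; apply: h; exact: leqW|exact: h].
  by move=> [h1 h2] s; rewrite leq_eqVlt => /orP[/eqP->|]//; exact: h1.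
have m3 : measurable (low t `&` [set w | a < M t.+1 w]).
  rewrite (_ : _ `&` _ = low t `\` low t.+1); first exact: measurableD.
  by rewrite setDE e1 setIUr setICr set0U setIA setIid.
rewrite e1 measureU//; last 2 first.
- exact: measurableC.
- by rewrite setIA setICl set0I.
rewrite e2 muleDr//; last by rewrite ge0_adde_def// inE measure_ge0.
rewrite -addeA leeD2l//; apply: le_trans mS _; exact/M_step/H_low.
Qed.

(** The events [low t] decrease to the event considered, and each has probability at least 1 - 1/a
    once the nonnegative integral in [ville_finite] is dropped; continuity from above gives the
    limit. *)
Lemma ville : measurable [set w | forall t, M t w <= a] /\
  ((1 - a^-1)%:E <= P [set w | forall t, (M t w <= a)%R])%E.
Proof.
have e : [set w | forall t, M t w <= a] = \bigcap_t low t.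
  apply/seteqP; split => w /=; first by move=> h t _ s _.
  by move=> h t; exact: (h t I t).
rewrite e; split; first exact: bigcapT_measurable.
have cv : P (low t) @[t --> \oo] --> P (\bigcap_t low t).
  apply: nonincreasing_cvg_mu => //.
  - by apply: (le_lt_trans (probability_le1 P (low_meas 0))); rewrite ltry.
  - exact: bigcapT_measurable.
  - move=> m n mn; apply/subsetPset => w h s sm; apply: h.
    exact: leq_trans mn.
have /cvg_lim <- // := cv.
apply: lime_ge; first by apply/cvg_ex; eexists; exact: cv.
apply: nearW => t.
have h := ville_finite t.
have {}h : (a%:E * P (~` low t) <= 1)%E.
  by apply: le_trans h; apply: leeDl; apply: integral_ge0 => w _; rewrite lee_fin.
rewrite -[low t]setCK probability_setC; last exact: measurableC.
have mC : measurable (~` low t) by exact: measurableC.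
rewrite -(fineK (fin_num_measure P _ mC)) in h *.
rewrite -EFinD lee_fin lerD2l lerN2.
by move: h; rewrite -EFinM lee_fin mulrC -ler_pdivlMr// mul1r.
Qed.

End Ville.

(** * The supermartingale *)

Lemma expR_half_ln (R : realType) (r : R) : 0 < r ->
  expR (- (2^-1 * ln r)) = (Num.sqrt r)^-1.
Proof. by move=> r0; rewrite expRN -powR12_sqrt ?ltW// /powR gt_eqF. Qed.

Lemma info_gain_ge0 (R : realType) (E : Type) (k : E -> E -> R) (Xs : set E)
    (xs : nat -> E) (l : R) t :
  (forall a b, Xs a -> Xs b -> k a b = k b a) -> pd_kernel k Xs ->
  (forall t, Xs (xs t.+1)) -> 0 < l -> 0 <= info_gain k xs l t.
Proof.
move=> k_sym k_pd xsX l0; elim: t => [|t ih]; first by rewrite info_gain0.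
rewrite info_gainS addr_ge0// mulr_ge0 ?invr_ge0// ln_ge0// lerDl divr_ge0 ?(ltW l0)//.
exact: (post_var_ge0 k_sym k_pd xsX).
Qed.

Section SelfNormalized.
Variables (R : realType) (E : topologicalType) (Xs : set E) (k : E -> E -> R).
Context d (T : measurableType d) (P : probability T R).
Variables (H : nat -> set (set T)) (x : nat -> T -> E) (xi : nat -> T -> R).
Variables (l : R).
Hypothesis Xs_compact : compact Xs.
Hypothesis k_cont : {within Xs `*` Xs, continuous (fun p : E * E => k p.1 p.2)}.
Hypothesis k_sym : forall a b, Xs a -> Xs b -> k a b = k b a.
Hypothesis k_pd : pd_kernel k Xs.
Hypothesis H_sigma : forall t, sigma_algebra setT (H t).
Hypothesis H_meas : forall t A, H t A -> measurable A.
Hypothesis H_incr : forall t A, H t A -> H t.+1 A.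
Hypothesis xX : forall t w, Xs (x t.+1 w).
Hypothesis x_pred : forall t, meas_wrt_top (H t) (x t.+1).
Hypothesis l0 : 0 < l.

Local Notation HT t := (g_sigma_algebraType (H t)).

Hypothesis xi_adapted : forall t, measurable_fun [set: HT t.+1] (xi t.+1).

Lemma filtration_le s t A : (s <= t)%N -> H s A -> H t A.
Proof.
move=> /subnKC <-; elim: (t - s)%N => [|n ih] hA; first by rewrite addn0.
by rewrite addnS; apply: H_incr; exact: ih.
Qed.

Lemma filtration_borel_map s t : (s <= t)%N ->
  borel_map (S := HT t) (x s.+1).
Proof.
move=> st U oU; apply/(g_sigma_measurableE (H_sigma t)).
by apply: (filtration_le st); apply: x_pred; exact: sub_sigma_algebra.
Qed.

Lemma filtration_measurable_fun d' (S : measurableType d') s t (f : T -> S) :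
  (s <= t)%N -> measurable_fun [set: HT s] f -> measurable_fun [set: HT t] f.
Proof.
move=> st mf _ B mB; rewrite setTI; apply/(g_sigma_measurableE (H_sigma t)).
apply: (filtration_le st); apply/(g_sigma_measurableE (H_sigma s)).
by have := mf measurableT B mB; rewrite setTI.
Qed.

Let mean t w := post_mean k (x^~ w) (xi^~ w) l t (x t.+1 w).
Let var t w := post_var k (x^~ w) l t (x t.+1 w).
Let energy t w := fit_energy k (x^~ w) (xi^~ w) l t.
Let gain t w := info_gain k (x^~ w) l t.

Let x_meas t s : (s < t)%N -> borel_map (S := HT t) (x s.+1).
Proof. by move=> st; apply: filtration_borel_map; exact: ltnW. Qed.

Let xi_meas t s : (s < t)%N -> measurable_fun [set: HT t] (xi s.+1).
Proof. by move=> st; apply: (filtration_measurable_fun st). Qed.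

Let mean_meas t : measurable_fun [set: HT t] (mean t).
Proof.
apply: (@measurable_post_mean R E Xs k Xs_compact k_cont k_sym k_pd _ (HT t) x
  xX l t l0 _ xi (x t.+1)) => //.
- exact: x_meas.
- exact: xi_meas.
- exact: filtration_borel_map.
Qed.

Let var_meas t : measurable_fun [set: HT t] (var t).
Proof.
apply: (@measurable_post_var R E Xs k Xs_compact k_cont k_sym k_pd _ (HT t) x
  xX l t l0 _ (x t.+1)) => //.
- exact: x_meas.
- exact: filtration_borel_map.
Qed.

Let energy_meas t : measurable_fun [set: HT t] (energy t).
Proof.
apply: (@measurable_fit_energy R E Xs k Xs_compact k_cont k_sym k_pd _ (HT t) x
  xX l t l0 _ xi) => //.
- exact: x_meas.
- exact: xi_meas.
Qed.

Let gain_meas t : measurable_fun [set: HT t] (gain t).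
Proof.
apply: (@measurable_info_gain R E Xs k Xs_compact k_cont k_sym k_pd _ (HT t) x
  xX l t l0) => //.
exact: x_meas.
Qed.

Let var_ge0 t w : 0 <= var t w.
Proof. exact: (post_var_ge0 k_sym k_pd (xs := x^~ w) (fun s => xX s w) _ l0 (xX t w)). Qed.

Let energyS t w : energy t.+1 w = energy t w + xi t.+1 w ^+ 2 -
  l * (xi t.+1 w - mean t w) ^+ 2 / (var t w + l).
Proof. exact: (fit_energyS k_sym k_pd (xs := x^~ w) (fun s => xX s w)). Qed.

Section FixedProxy.
Variable sigma : R.
Hypothesis sigma_gt0 : 0 < sigma.
Hypothesis xi_subg : forall t (u : R) (A : set T), H t A ->
  (\int[P]_(w in A) (expR (u * xi t.+1 w))%:E <=
   (expR (u ^+ 2 * sigma ^+ 2 / 2))%:E * P A)%E.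

Definition mart t w := expR (energy t w / (2 * sigma ^+ 2) - gain t w).

Let mart_meas t : measurable_fun [set: HT t] (mart t).
Proof.
apply: (measurableT_comp (@measurable_expR R)).
by apply: measurable_funB => //; exact: measurable_funM.
Qed.

(** The sub-Gaussian bound is the only inequality here: both sides of [subgaussian_mixture] are
    rewritten exactly as the two integrals over [A]. *)
Lemma mart_step t A : H t A ->
  (\int[P]_(w in A) (mart t.+1 w)%:E <= \int[P]_(w in A) (mart t w)%:E)%E.
Proof.
move=> HA.
have vl w : 0 < var t w + l by rewrite ltr_wpDl.
have vl0 w : var t w + l != 0 by rewrite gt_eqF.
have sg0 : sigma != 0 by rewrite gt_eqF.
(* Write v, m for [var t w], [mean t w]. The increment of the energy divided by 2 sigma^2 is m0 xi +
   s^2 xi^2 / 2 - c, which dictates the three definitions. Then 1 - s^2 sigma^2 = l / (v + l) = 1 /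
   (1 + v / l), so the mixture factor cancels the increment of the gain, and m0^2 sigma^2 / (2 (1 -
   s^2 sigma^2)) equals c. *)
pose m0 w := l * mean t w / (sigma ^+ 2 * (var t w + l)).
pose s w := Num.sqrt (var t w / (var t w + l)) / sigma.
pose c w := l * mean t w ^+ 2 / (2 * sigma ^+ 2 * (var t w + l)).
(* All factors known at time t; the indicator turns integrals over [A] into integrals over the whole
   space. *)
pose Z w := \1_A w * (mart t w *
  expR (- (2^-1 * ln (1 + var t w / l)) - c w)).
have mvl : measurable_fun [set: HT t] (fun w => var t w + l).
  exact: measurable_funD.
have mm0 : measurable_fun [set: HT t] m0.
  apply: measurable_funM; first exact: measurable_funM.
  by apply: measurable_inv; exact: measurable_funM.
have ms : measurable_fun [set: HT t] s.
  apply: measurable_funM => //.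
  rewrite (_ : (fun _ => _) = (fun w => (var t w / (var t w + l)) `^ 2^-1)).
    apply: (measurableT_comp (measurable_powR _)).
    by apply: measurable_funM => //; exact: measurable_inv.
  by apply/funext => w; rewrite powR12_sqrt// divr_ge0// ltW.
have mc : measurable_fun [set: HT t] c.
  apply: measurable_funM; first by apply: measurable_funM => //; exact: measurable_funX.
  by apply: measurable_inv; exact: measurable_funM.
have mA : measurable (A : set (HT t)) by exact/(g_sigma_measurableE (H_sigma t)).
have mZ : measurable_fun [set: HT t] Z.
  apply: measurable_funM; first exact: measurable_indic.
  apply: measurable_funM => //; apply: (measurableT_comp (@measurable_expR R)).
  apply: measurable_funB => //; apply: measurable_funN.
  apply: measurable_funM => //; apply: (measurableT_comp (@measurable_ln R)).
  by apply: measurable_funD => //; exact: measurable_funM.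
have Z0 w : 0 <= Z w by rewrite !mulr_ge0 ?expR_ge0.
have s2 w : s w ^+ 2 * sigma ^+ 2 = var t w / (var t w + l).
  by rewrite /s exprMn sqr_sqrtr ?divr_ge0 ?(ltW (vl w))//; field; rewrite sg0 vl0.
have s1 w : s w ^+ 2 * sigma ^+ 2 < 1.
  by rewrite s2 ltr_pdivrMr// mul1r ltrDl.
have mxi : measurable_fun [set: T] (xi t.+1).
  exact: (g_sigma_measurable_fun (H_sigma t.+1) (@H_meas t.+1)).
have := subgaussian_mixture (H_sigma t) (@H_meas t) mxi (@xi_subg t)
  mm0 ms mZ Z0 s1.
rewrite (eq_integral (fun w => (EFin \o mart t.+1) \_ A w)); last first.
  move=> w _; rewrite patchE /Z indicE; case: ifP => _; last by rewrite !mul0r.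
  rewrite mul1r /= /mart energyS /gain info_gainS /= -!expRD; congr (expR _)%:E.
  have -> : s w ^+ 2 = var t w / (var t w + l) / sigma ^+ 2.
    by rewrite -s2 mulfK// expf_neq0.
  rewrite -/(gain t w) -/(var t w) /m0 /c; field.
  by rewrite sg0 vl0.
rewrite [X in (_ <= X)%E -> _](eq_integral (fun w => (EFin \o mart t) \_ A w)); last first.
  move=> w _; rewrite patchE /Z indicE; case: ifP => _; last by rewrite !mul0r.
  rewrite mul1r /= -mulrA; congr EFin.
  rewrite -[RHS]mulr1; congr (_ * _).
  have r0 : 0 < 1 + var t w / l by rewrite ltr_pwDl// divr_ge0// ltW.
  rewrite s2 expRD expR_half_ln//.
  have -> : 1 - var t w / (var t w + l) = (1 + var t w / l)^-1.
    have l1 : l != 0 by rewrite gt_eqF.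
    by field; rewrite l1 (addrC l) vl0.
  rewrite sqrtrV ?(ltW r0)// invrK mulrACA mulVf ?gt_eqF ?sqrtr_gt0// mul1r.
  rewrite -expRD -[RHS]expR0; congr expR.
  rewrite /c /m0; have l1 : l != 0 by rewrite gt_eqF.
  by field; rewrite l1 (addrC l) vl0 sg0.
by rewrite -!integral_mkcond.
Qed.

Let mart_measT t : measurable_fun [set: T] (mart t).
Proof. exact: (g_sigma_measurable_fun (H_sigma t) (@H_meas t)). Qed.

Let mart_low a t : H t [set w | forall s, (s <= t)%N -> mart s w <= a].
Proof.
apply/(g_sigma_measurableE (H_sigma t)).
rewrite (_ : [set _ | _] =
    \bigcap_s [set w | (s <= t)%N -> mart s w <= a]); last first.
  by apply/seteqP; split => w /= h s; [move=> _; exact: h|exact: h].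
apply: bigcapT_measurable => s; have [st|ts] := leqP s t; last first.
  by rewrite (_ : [set _ | _] = setT)//; apply/seteqP; split.
have ms := filtration_measurable_fun st (mart_meas (t := s)).
rewrite (_ : [set _ | _] = mart s @^-1` `]-oo, a]).
  by rewrite -[X in measurable X]setTI; exact: ms.
by apply/seteqP; split => w /=; rewrite in_itv/=; [apply|move=> h _].
Qed.

Let bound (s delta : R) := [set w | forall t,
  energy t w <= s ^+ 2 * (2 * ln delta^-1 + 2 * gain t w)].

Lemma energy_bound_gt0 (delta : R) : 0 < delta ->
  measurable (bound sigma delta) /\ ((1 - delta)%:E <= P (bound sigma delta))%E.
Proof.
move=> d0; have d0' : 0 < delta^-1 by rewrite invr_gt0.
have e t w : (mart t w <= delta^-1) =
    (energy t w <= sigma ^+ 2 * (2 * ln delta^-1 + 2 * gain t w)).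
  rewrite /mart -[X in _ <= X]lnK ?posrE// ler_expR.
  rewrite [LHS]lerBlDr [LHS]ler_pdivrMr ?mulr_gt0 ?exprn_gt0//.
  by congr (_ <= _); ring.
have -> : bound sigma delta = [set w | forall t, mart t w <= delta^-1].
  by apply/seteqP; split => w /= h t; have := h t; rewrite e.
rewrite -[X in (1 - X)%:E]invrK.
apply: (ville (H := H)) => //.
- by move=> t w; exact: expR_ge0.
- under eq_integral => w _ do
    rewrite /mart /energy fit_energy0 /gain info_gain0 mul0r subr0 expR0.
  by rewrite (integral_cst P measurableT) mul1e probability_le1.
- exact: mart_step.
Qed.

End FixedProxy.

Let bound (s delta : R) := [set w | forall t,
  energy t w <= s ^+ 2 * (2 * ln delta^-1 + 2 * gain t w)].

(* The supermartingale divides by sigma, so sigma = 0 is reached as the limit of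
   the proxies sigma + 1 / (n + 1). *)
Lemma energy_bound (sigma delta : R) : 0 <= sigma -> 0 < delta <= 1 ->
  (forall t (u : R) (A : set T), H t A ->
    (\int[P]_(w in A) (expR (u * xi t.+1 w))%:E <=
     (expR (u ^+ 2 * sigma ^+ 2 / 2))%:E * P A)%E) ->
  measurable (bound sigma delta) /\ ((1 - delta)%:E <= P (bound sigma delta))%E.
Proof.
move=> s0 /andP[d0 d1] subg.
pose sn n : R := sigma + harmonic n.
have sn0 n : 0 < sn n by rewrite ltr_wpDl// harmonic_gt0.
have snsg n : sigma <= sn n by rewrite lerDl harmonic_ge0.
(* This sign makes the bound increase with the proxy, so the events for [sn n] decrease to the one
   for [sigma]. It rests on [delta] being at most 1. *)
have L0 t w : 0 <= 2 * ln delta^-1 + 2 * gain t w.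
  apply: addr_ge0; apply: mulr_ge0 => //; first by rewrite ln_ge0// invf_ge1.
  exact: (info_gain_ge0 _ k_sym k_pd (xs := x^~ w) (fun s => xX s w) l0).
have subgn n t (u : R) (A : set T) : H t A ->
    (\int[P]_(w in A) (expR (u * xi t.+1 w))%:E <=
     (expR (u ^+ 2 * sn n ^+ 2 / 2))%:E * P A)%E.
  move=> HA; apply: le_trans (subg _ _ _ HA) _.
  apply: lee_wpmul2r; first exact: measure_ge0.
  rewrite lee_fin ler_expR ler_pM2r// ler_wpM2l ?sqr_ge0//.
  by rewrite ler_pXn2r ?nnegrE ?(ltW (sn0 n)).
have bnd n := energy_bound_gt0 (sn0 n) (subgn n) d0.
have e : bound sigma delta = \bigcap_n bound (sn n) delta.
  apply/seteqP; split => w /= h.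
    move=> n _ t; apply: le_trans (h t) _; apply: ler_wpM2r => //.
    by rewrite ler_pXn2r ?nnegrE ?(ltW (sn0 n)).
  move=> t.
  have cv : (fun n => sn n ^+ 2 * (2 * ln delta^-1 + 2 * gain t w)) @ \oo -->
      sigma ^+ 2 * (2 * ln delta^-1 + 2 * gain t w).
    apply: cvgM; last exact: cvg_cst.
    have c1 : sn n @[n --> \oo] --> sigma.
      rewrite -[X in _ --> X]addr0.
      by apply: cvgD; [exact: cvg_cst|exact: cvg_harmonic].
    by rewrite expr2; under eq_cvg do rewrite expr2; exact: cvgM.
  have := ler_cvg_to (cvg_cst (energy t w)) cv; apply.
  by apply: nearW => n; exact: h.
rewrite e; have mb : measurable (\bigcap_n bound (sn n) delta).
  by apply: bigcapT_measurable => n; exact: (bnd n).1.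
split => //.
have cv : P (bound (sn n) delta) @[n --> \oo] -->
    P (\bigcap_n bound (sn n) delta).
  apply: nonincreasing_cvg_mu => //.
  - by apply: (le_lt_trans (probability_le1 P (bnd 0).1)); rewrite ltry.
  - by move=> n; exact: (bnd n).1.
  - move=> m n mn; apply/subsetPset => w h t; apply: le_trans (h t) _.
    apply: ler_wpM2r => //.
    rewrite ler_pXn2r ?nnegrE ?(ltW (sn0 _))// lerD2l /harmonic.
    by rewrite lef_pV2 ?posrE// ler_nat.
have /cvg_lim <- // := cv.
apply: lime_ge; first by apply/cvg_ex; eexists; exact: cv.
by apply: nearW => n; exact: (bnd n).2.
Qed.

End SelfNormalized.

(** * Bias and noise together *)

Unset Implicit Arguments.

Theorem theorem2
  (R : realType) (E : topologicalType) (Xs : set E) (k : E -> E -> R)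
  (d : measure_display) (T : measurableType d) (P : probability T R)
  (H : nat -> set (set T))
  (x : nat -> T -> E) (y : nat -> T -> R) (lam : nat -> T -> R)
  (fstar : E -> R) (fnorm sigma lamstar delta : R) :
  compact Xs ->
  {within Xs `*` Xs, continuous (fun p : E * E => k p.1 p.2)} ->
  (forall a b, Xs a -> Xs b -> k a b = k b a) ->
  pd_kernel k Xs ->
  rkhs_norm_is k Xs fstar fnorm ->
  (* filtration *)
  (forall t, sigma_algebra setT (H t)) ->
  (forall t A, H t A -> measurable A) ->
  (forall t A, H t A -> H t.+1 A) ->
  (* predictable design points and observations *)
  (forall t w, Xs (x t.+1 w)) ->
  (forall t, meas_wrt_top (H t) (x t.+1)) ->
  (forall t, meas_wrt_R (H t.+1) (y t.+1)) ->
  (* conditional sub-Gaussian noise xi_t = y_t - fstar(x_t):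
     E[exp(u xi_t) | H_{t-1}] <= exp(u^2 sigma^2 / 2) a.s., written out as
     E[exp(u xi_t) 1_A] <= exp(u^2 sigma^2/2) P(A) for all A in H_{t-1} *)
  0 <= sigma ->
  (forall t (u : R) (A : set T), H t A ->
     (\int[P]_(w in A) (expR (u * (y t.+1 w - fstar (x t.+1 w))))%:E <=
      (expR (u ^+ 2 * sigma ^+ 2 / 2))%:E * P A)%E) ->
  (* predictable regularisation parameters, bounded below by lamstar > 0 *)
  0 < lamstar ->
  (forall t, meas_wrt_R (H t) (lam t.+1)) ->
  (forall t w, lamstar <= lam t.+1 w) ->
  0 < delta <= 1 ->
  exists A : set T, [/\ measurable A, (P A >= (1 - delta)%:E)%E &
    forall w, A w -> forall (z : E) (t : nat), Xs z ->
      `| fstar z - post_mean k (fun s => x s w) (fun s => y s w) (lam t.+1 w) t z |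
      <= Num.sqrt (post_var k (fun s => x s w) (lam t.+1 w) t z / lam t.+1 w) *
         (Num.sqrt (lam t.+1 w) * fnorm +
          sigma * Num.sqrt (2 * ln (delta^-1)
                            + 2 * info_gain k (fun s => x s w) lamstar t))].

Proof.
move=> Xc kc ksym kpd fB Hs Hm Hi xX xp ya s0 subg ls0 lp lge dlt.
pose xi s w := y s w - fstar (x s w).
have xia t : measurable_fun [set: g_sigma_algebraType (H t.+1)] (xi t.+1).
  have xb := filtration_borel_map Hs Hi xp (leqnSn t).
  (* The noise is defined by subtraction, so its adaptedness requires that of [fstar] along the
     design points. *)
  have mf := @measurable_rkhs _ _ _ _ kc ksym _ (g_sigma_algebraType (H t.+1))
    _ _ _ fB (xX t) xb.
  apply: measurable_funB; last exact: mf.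
  move=> _ B mB; rewrite setTI; apply/(g_sigma_measurableE (Hs t.+1)).
  exact: ya.
have [mA PA] := energy_bound Xc kc ksym kpd Hs Hm Hi xX xp ls0 xia s0 dlt subg.
eexists; split; [exact: mA|exact: PA|] => w Aw z t zX.
have l0 : 0 < lam t.+1 w by exact: lt_le_trans (lge t w).
have xwX s : Xs (x s.+1 w) by exact: xX.
set l := lam t.+1 w in l0 *.
set pv := post_var _ _ _ _ _.
have pv0 : 0 <= pv by exact: (post_var_ge0 ksym kpd xwX).
have pvl0 : 0 <= pv / l by rewrite divr_ge0// ltW.
set L := 2 * _ + _.
(* The estimator is linear in the observations: its value on [fstar] gives the bias, its value on
   [xi] the noise, matching the two terms of the bracket. *)
have -> : post_mean k (x^~ w) (y^~ w) l t z =
    post_mean k (x^~ w) (fun s => fstar (x s w)) l t z +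
    post_mean k (x^~ w) (xi^~ w) l t z.
  rewrite -post_meanD; apply: post_mean_ext => s.
  by rewrite /xi addrC subrK.
rewrite opprD addrA; apply: le_trans (ler_normB _ _) _.
rewrite mulrDr; apply: lerD.
  apply: le_trans (post_mean_bias ksym kpd xwX t fB l0 zX) _.
  by rewrite mulrA -sqrtrM// divfK// gt_eqF.
have noise : post_mean k (x^~ w) (xi^~ w) l t z ^+ 2 <= pv / l * (sigma ^+ 2 * L).
  apply: le_trans (post_mean_sqr_le ksym kpd xwX (xi^~ w) t l0 zX) _.
  apply: ler_wpM2l => //; apply: le_trans (Aw t).
  exact: (fit_energy_anti ksym kpd xwX (xi^~ w) t ls0 (lge t w)).
rewrite -sqrtr_sqr; apply: le_trans (ler_wsqrtr noise) _.
rewrite (sqrtrM _ pvl0) (sqrtrM _ (sqr_ge0 sigma)).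
by rewrite sqrtr_sqr ger0_norm.
Qed.
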